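(* Let $n\in\{9,10,11\}$. There are no rigid complex filiform Lie algebras of dimension $n$; that is, for every filiform Lie bracket $\mu$ on $\mathbb{C}^n$, the orbit $O(\mu)$ is not open in $\mathcal{L}^n$ in the Euclidean topology. Moreover, for every $\mu\in\mathcal{F}^n$ and every Euclidean neighborhood $V$ of $\mu$ in $\mathcal{F}^n$, there is a filiform Lie bracket $\nu\in V$ that is not isomorphic to $\mu$.
   Context: $\mathcal{L}^n$ is the algebraic set of all alternating bilinear maps $\mu:\mathbb{C}^n\times\mathbb{C}^n\to\mathbb{C}^n$ satisfying the Jacobi identity. The orbit $O(\mu)$ of $\mu$ under the natural action of $GL_n(\mathbb{C})$ by change of basis is the isomorphism class of $\mu$. $\mu$ is rigid if $O(\mu)$ is open in $\mathcal{L}^n$ for the Euclidean topology. A Lie algebra of dimension $n$ is filiform if it is nilpotent of maximal nilpotency class $n-1$. The variety $\mathcal{F}^n$. Let $x_0,\dots,x_{n-1}$ be a basis of $\mathbb{C}^n$. Let $\mu_0$ be the alternating bilinear map with $\mu_0(x_0,x_j)=x_{j+1}$ for $1\le j\le n-2$, and $\mu_0(x_i,x_j)=0$ for all other $i<j$. Let $\Delta_n=\{(r,s): 1\le r\le n-2,\ 2r+1<s\le n-1\}$ if $n$ is odd, and $\Delta_n=\{(r,s): 1\le r\le n-2,\ 2r+1<s\le n-1\}\cup\{(\tfrac{n-2}{2},n-1)\}$ if $n$ is even. For $(r,s)\in\Delta_n$ let $\psi_{r,s}$ be the alternating bilinear map with $$\psi_{r,s}(x_i,x_j)=-\psi_{r,s}(x_j,x_i)=(-1)^{r-i}\binom{j-r-1}{r-i}x_{i+j+s-2r-1}$$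 for $1\le i\le r<j\le n-1$ and $i+j+s-2r-1\le n-1$, and $\psi_{r,s}(x_i,x_j)=0$ otherwise. $\mathcal{F}^n$ is the algebraic set of tuples $(a_{r,s})_{(r,s)\in\Delta_n}$ of complex numbers such that $\psi=\sum_{(r,s)\in\Delta_n}a_{r,s}\psi_{r,s}$ satisfies $\psi(\psi(X,Y),Z)+\psi(\psi(Y,Z),X)+\psi(\psi(Z,X),Y)=0$ for all $X,Y,Z$. The tuple is identified with the filiform Lie bracket $\mu=\mu_0+\psi$. By a known result (Vergne), every filiform Lie bracket on $\mathbb{C}^n$ has this form with respect to a suitable basis of $\mathbb{C}^n$, called an adapted basis. *)

(* Defs.v *)
From HB Require Import structures.
From mathcomp Require Import all_boot all_order all_algebra.
From mathcomp Require Import complex.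
From mathcomp Require Import all_classical all_reals all_analysis.

Set Implicit Arguments.
Unset Strict Implicit.
Unset Printing Implicit Defensive.

Import Order.TTheory GRing.Theory Num.Theory.
Import numFieldNormedType.Exports.

Local Open Scope classical_set_scope.
Local Open Scope ring_scope.

(* The complex numbers over R.  Naming the numClosedFieldType (instead of using
   R[i] directly) makes the topology of a numFieldType inferable; its balls are
   the discs |x - y| < e, so it is the Euclidean topology. *)
Definition Cplx (R : realType) : numClosedFieldType := complex R.

(* A bilinear map C^n x C^n -> C^n is encoded by its structure constants: the
   entry (i, j) is the image of the pair (e_i, e_j) of basis vectors. The
   entrywise topology on this matrix type is the Euclidean topology of the
   n^3-dimensional space of bilinear maps. *)
Definition bilmap (R : realType) (n : nat) := 'M['cV[Cplx R]_n]_n.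

Definition br (R : realType) (n : nat) (mu : bilmap R n)
    (x y : 'cV[Cplx R]_n) : 'cV[Cplx R]_n :=
  \sum_(i < n) \sum_(j < n) (x i ord0 * y j ord0) *: mu i j.

Definition jacobi (R : realType) (n : nat) (mu : bilmap R n) : Prop :=
  forall x y z : 'cV[Cplx R]_n,
    br mu (br mu x y) z + br mu (br mu y z) x + br mu (br mu z x) y = 0.

Definition lie_variety (R : realType) (n : nat) : set (bilmap R n) :=
  [set mu | (forall x, br mu x x = 0) /\ jacobi mu].

Definition gl_act (R : realType) (n : nat) (g : 'M[Cplx R]_n) (mu : bilmap R n) :
    bilmap R n :=
  \matrix_(i < n, j < n)
    (g *m br mu (invmx g *m delta_mx i ord0) (invmx g *m delta_mx j ord0)).

Definition gl_orbit (R : realType) (n : nat) (mu : bilmap R n) : set (bilmap R n) :=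
  [set nu | exists2 g : 'M[Cplx R]_n, g \in unitmx & nu = gl_act g mu].

Definition isomorphic (R : realType) (n : nat) (mu nu : bilmap R n) : Prop :=
  gl_orbit mu nu.

Definition rigid (R : realType) (n : nat) (mu : bilmap R n) : Prop :=
  lie_variety mu /\ open (gl_orbit mu : set (subspace (@lie_variety R n))).

(* Lower central series, starting with lcs mu 0 = C^n. *)
Fixpoint lcs (R : realType) (n : nat) (mu : bilmap R n) (k : nat) :
    {vspace 'cV[Cplx R]_n} :=
  if k is k'.+1 then
    (<<[seq br mu x y | x <- vbasis (@fullv _ 'cV[Cplx R]_n),
                        y <- vbasis (lcs mu k')]>>)%VS
  else fullv.

Definition nilpotent_of_class (R : realType) (n : nat) (mu : bilmap R n)
    (c : nat) : Prop :=
  lcs mu c = 0%VS /\ (forall k, (k < c)%N -> lcs mu k <> 0%VS).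

Definition filiform (R : realType) (n : nat) (mu : bilmap R n) : Prop :=
  lie_variety mu /\ nilpotent_of_class mu n.-1.

(* The basis vector x_k for k < n (and 0 for k >= n). *)
Definition bvec (R : realType) (n k : nat) : 'cV[Cplx R]_n :=
  \col_(l < n) ((l == k :> nat)%:R).

(* The alternating bilinear map with value f i j on (x_i, x_j) for i < j. *)
Definition alt_map (R : realType) (n : nat) (f : nat -> nat -> 'cV[Cplx R]_n) :
    bilmap R n :=
  \matrix_(i < n, j < n)
    (if (i < j)%N then f i j else if (j < i)%N then - f j i else 0).

Definition mu0 (R : realType) (n : nat) : bilmap R n :=
  alt_map (fun i j =>
    if (i == 0%N) && (1 <= j <= n - 2)%N then bvec R n j.+1 else 0).

Definition Delta (n : nat) : {set 'I_n * 'I_n} :=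
  [set p : 'I_n * 'I_n |
    let r := nat_of_ord p.1 in let s := nat_of_ord p.2 in
    [&& 1 <= r, r <= n - 2, 2 * r + 1 < s & s <= n - 1]%N
    || [&& ~~ odd n, r == (n - 2) %/ 2 & s == n - 1]%N]%SET.

(* For (r, s) in Delta n one has 2r+1 <= s, so no subtraction on nat used at the
   indices 1 <= i <= r < j below is truncated. *)
Definition psi (R : realType) (n r s : nat) : bilmap R n :=
  alt_map (fun i j =>
    if [&& 1 <= i, i <= r, r < j, j <= n - 1
         & i + j + s - (2 * r + 1) <= n - 1]%N
    then ((-1) ^+ (r - i) * ('C(j - r - 1, r - i))%:R)
           *: bvec R n (i + j + s - (2 * r + 1))
    else 0).

(* Tuples indexed by Delta n, with the (finite) product topology. *)
Definition coords (R : realType) (n : nat) :=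
  {ptws {p : 'I_n * 'I_n | p \in Delta n} -> Cplx R}.

Definition psi_sum (R : realType) (n : nat) (a : coords R n) : bilmap R n :=
  \matrix_(i < n, j < n)
    \sum_(p : {p : 'I_n * 'I_n | p \in Delta n})
      a p *: psi R n (val p).1 (val p).2 i j.

Definition Fvar (R : realType) (n : nat) : set (coords R n) :=
  [set a | jacobi (psi_sum a)].

Definition bracket_of (R : realType) (n : nat) (a : coords R n) : bilmap R n :=
  mu0 R n + psi_sum a.

(* Main.v *)
(* Give the coefficient [a_(r, s)] the weight [s - 2 r - 1]. The matrix of an isomorphism
   between two brackets of the variety [F^n] is triangular, so up to a common factor it acts
   trivially on the coefficients of lowest weight: the point [(a_(1,4) : a_(2,6))] is an
   invariant, and so is [(a_(1,5) : a_(2,7))] when [a_(1,4) = a_(2,6) = 0] or, after a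
   correction, when [n = 10] and [a_(4,9) != 0]. For [n = 9, 10, 11] the Jacobi identity
   amounts to one, three or four equations, homogeneous for the weight, and through each of
   their solutions passes an explicit rational curve of solutions along which one of these
   invariants moves. By Vergne's theorem a filiform bracket is isomorphic to one of [F^n],
   so its orbit cannot be open. *)

From HB Require Import structures.
Require Import Defs.
From mathcomp Require Import all_boot all_order all_algebra.
From mathcomp Require Import complex.
From mathcomp Require Import all_classical all_reals all_analysis.
Import numFieldNormedType.Exports.
From mathcomp Require Import ring zify.

Set Implicit Arguments.
Unset Strict Implicit.
Unset Printing Implicit Defensive.

Import Order.TTheory GRing.Theory Num.Theory.

Local Open Scope classical_set_scope.
Local Open Scope ring_scope.

(** * Bilinear maps on [C^n], change of basis and isomorphism *)

Section Bilinear.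
Variables (R : realType) (n : nat).
Local Notation C := (Cplx R).
Local Notation V := 'cV[C]_n.
Implicit Types (mu nu : bilmap R n) (x y z : V) (c : C) (g h : 'M[C]_n).

(** A tangent direction to quadratic equations need not integrate to a curve. Rational curves are
    available here because every equation has degree one in some parameter. Up to sign, [a_(3,8)],
    [a_(3,9)] and [a_(3,10)] enter the equations of weights 2, 3 and 4 with the same coefficient
    [D = 2 a_(1,4) + a_(2,6)]. Where [D] is not zero, moving [(a_(1,4), a_(2,6))] in the direction
    [(1, -2)] keeps [D] constant, and these parameters are solved for. Where [D = 0], the first
    equation forces [a_(1,4) = a_(2,6) = 0]; then another nonzero parameter serves as denominator,
    or so many terms drop out that an invariant moves freely.

    An isomorphism is determined by the images of [x_0] and [x_1], since [x_(j+1) = [x_0, x_j]] for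
    [j >= 1], and in the lowest weights only three of its matrix entries survive. Vergne's theorem
    is proved as well: [x_0] is chosen generic for the action on the quotients of the lower central
    series, and since [ad x_0] is a derivation, the brackets of consecutive basis vectors determine
    all others. *)

Lemma br_linear_r mu x : linear (br mu x).
Proof.
move=> c y z; rewrite /br scaler_sumr -big_split; apply: eq_bigr => i _ /=.
rewrite scaler_sumr -big_split; apply: eq_bigr => j _ /=.
by rewrite !mxE mulrDr scalerDl scalerA mulrCA.
Qed.

Lemma br_linear_l mu y : linear (fun x => br mu x y).
Proof.
move=> c x z; rewrite /br scaler_sumr -big_split; apply: eq_bigr => i _ /=.
rewrite scaler_sumr -big_split; apply: eq_bigr => j _ /=.
by rewrite !mxE mulrDl scalerDl scalerA mulrA.
Qed.

HB.instance Definition _ mu x :=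
  GRing.isLinear.Build C V V *:%R (br mu x) (br_linear_r mu x).
Definition brl mu y x := br mu x y.
HB.instance Definition _ mu y :=
  GRing.isLinear.Build C V V *:%R (brl mu y) (br_linear_l mu y).

Lemma brDr mu x y z : br mu x (y + z) = br mu x y + br mu x z.
Proof. exact: linearD. Qed.
Lemma brDl mu x y z : br mu (x + y) z = br mu x z + br mu y z.
Proof. exact: (linearD (brl mu z)). Qed.
Lemma brZr mu c x y : br mu x (c *: y) = c *: br mu x y.
Proof. exact: linearZ. Qed.
Lemma brZl mu c x y : br mu (c *: x) y = c *: br mu x y.
Proof. exact: (linearZ_LR (brl mu y)). Qed.
Lemma br0l mu x : br mu 0 x = 0.
Proof. exact: (linear0 (brl mu x)). Qed.
Lemma brNr mu x y : br mu x (- y) = - br mu x y.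
Proof. exact: linearN. Qed.
Lemma brNl mu x y : br mu (- x) y = - br mu x y.
Proof. exact: (linearN (brl mu y)). Qed.
Lemma br_sumr mu x I (r : seq I) (P : pred I) (F : I -> V) :
  br mu x (\sum_(i <- r | P i) F i) = \sum_(i <- r | P i) br mu x (F i).
Proof. exact: linear_sum. Qed.
Lemma br_suml mu x I (r : seq I) (P : pred I) (F : I -> V) :
  br mu (\sum_(i <- r | P i) F i) x = \sum_(i <- r | P i) br mu (F i) x.
Proof. exact: (linear_sum (brl mu x)). Qed.

Lemma br_delta mu (i j : 'I_n) :
  br mu (delta_mx i ord0) (delta_mx j ord0) = mu i j.
Proof.
rewrite /br (bigD1 i) //= (bigD1 j) //= !mxE !eqxx mul1r scale1r.
rewrite !big1 ?addr0 // => [k /negPf ki|k /negPf kj].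
  by rewrite big1 // => l _; rewrite !mxE ki mul0r scale0r.
by rewrite !mxE eqxx kj mulr0 scale0r.
Qed.

Lemma col_sum_delta x : x = \sum_(i < n) x i ord0 *: delta_mx i ord0.
Proof.
rewrite {1}(matrix_sum_delta x); apply: eq_bigr => i _.
by rewrite big_ord1.
Qed.

Lemma br_act g mu x y : g \in unitmx ->
  br (gl_act g mu) (g *m x) (g *m y) = g *m br mu x y.
Proof.
move=> gU.
have H u v : br (gl_act g mu) u v = g *m br mu (invmx g *m u) (invmx g *m v).
  rewrite [in RHS](col_sum_delta u) [in X in br mu X]mulmx_sumr br_suml mulmx_sumr.
  rewrite {1}/br; apply: eq_bigr => i _.
  rewrite [in RHS](col_sum_delta v) [X in br mu _ X]mulmx_sumr br_sumr mulmx_sumr.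
  apply: eq_bigr => j _.
  by rewrite -!scalemxAr brZl brZr -!scalemxAr scalerA mxE.
by rewrite H !mulKmx.
Qed.

Lemma bilmap_ext mu nu : (forall x y, br mu x y = br nu x y) -> mu = nu.
Proof. by move=> H; apply/matrixP => i j; rewrite -!br_delta H. Qed.

Lemma hom_gl_act g mu nu : g \in unitmx ->
  (forall x y, br nu (g *m x) (g *m y) = g *m br mu x y) -> nu = gl_act g mu.
Proof.
move=> gU H; apply: bilmap_ext => x y.
by rewrite -(mulKVmx gU x) -(mulKVmx gU y) H br_act.
Qed.

Lemma isomorphic_sym mu nu : isomorphic mu nu -> isomorphic nu mu.
Proof.
case=> g gU ->; exists (invmx g); first by rewrite unitmx_inv.
apply: hom_gl_act; rewrite ?unitmx_inv // => x y.
by rewrite -[in RHS](mulKVmx gU x) -[in RHS](mulKVmx gU y) br_act // mulKmx.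
Qed.

Lemma isomorphic_trans mu nu pi :
  isomorphic mu nu -> isomorphic nu pi -> isomorphic mu pi.
Proof.
case=> g gU -> [h hU ->]; exists (h *m g); first by rewrite unitmx_mul hU.
apply: hom_gl_act; first by rewrite unitmx_mul hU.
by move=> x y; rewrite -!mulmxA !br_act.
Qed.

Lemma lie_variety_act g mu :
  g \in unitmx -> lie_variety mu -> lie_variety (gl_act g mu).
Proof.
move=> gU [altm jacm]; split=> [x|x y z].
  by rewrite -(mulKVmx gU x) br_act // altm mulmx0.
rewrite -(mulKVmx gU x) -(mulKVmx gU y) -(mulKVmx gU z).
by rewrite !br_act // -!mulmxDr jacm mulmx0.
Qed.

Lemma br_anti mu x y : (forall z, br mu z z = 0) -> br mu x y = - br mu y x.
Proof.
move=> altm; have /eqP := altm (x + y).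
by rewrite brDl !brDr !altm add0r addr0 addr_eq0 => /eqP.
Qed.

Lemma alt_of_delta mu :
  (forall i j, mu i j = - mu j i) -> (forall i, mu i i = 0) ->
  forall x, br mu x x = 0.
Proof.
move=> anti diag x; suff: br mu x x = - br mu x x.
  by move/eqP; rewrite -addr_eq0 -mulr2n -scaler_nat scaler_eq0 pnatr_eq0 => /eqP.
rewrite {1}/br exchange_big /= /br -sumrN; apply: eq_bigr => i _.
rewrite -sumrN; apply: eq_bigr => j _.
by rewrite [mu j i]anti scalerN (mulrC (x j ord0)).
Qed.

Lemma linear_delta0 (f : V -> V) :
  linear f -> (forall i, f (delta_mx i ord0) = 0) -> forall x, f x = 0.
Proof.
move=> lf f0 x; pose g := HB.pack_for {linear V -> V} f (GRing.isLinear.Build C V V *:%R f lf).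
have -> : f x = g x by [].
rewrite (col_sum_delta x) linear_sum big1 // => i _.
by rewrite linearZ /= f0 scaler0.
Qed.

Lemma jacobi_delta mu :
  (forall i j k, br mu (mu i j) (delta_mx k ord0) + br mu (mu j k) (delta_mx i ord0)
     + br mu (mu k i) (delta_mx j ord0) = 0) -> jacobi mu.
Proof.
move=> H x y z; move: x; apply: linear_delta0 => [c x x'|i].
  by rewrite !(brDl, brDr, brZl, brZr) !scalerDr (addrACA (c *: _) _ (c *: _))
    (addrACA (_ + _) _ (c *: _)).
move: y; apply: linear_delta0 => [c y y'|j].
  by rewrite !(brDl, brDr, brZl, brZr) !scalerDr (addrACA (c *: _) _ (c *: _))
    (addrACA (_ + _) _ (c *: _)).
move: z; apply: linear_delta0 => [c z z'|k].
  by rewrite !(brDl, brDr, brZl, brZr) !scalerDr (addrACA (c *: _) _ (c *: _))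
    (addrACA (_ + _) _ (c *: _)).
by rewrite !br_delta H.
Qed.

End Bilinear.

(** * Structure constants of [psi] *)

Section StructureConstants.
Variable F : comNzRingType.
Implicit Types (A : nat -> nat -> F) (n i j k l r s : nat).

(** Both parities at once: [s = 2 r + 1 = n - 1] is possible only for even [n], and is then the
    additional pair [((n - 2) / 2, n - 1)]. *)
Definition in_Delta n r s :=
  [&& 0 < r, (2 * r).+1 <= s, s < n & (s == (2 * r).+1) ==> (s == n.-1)]%N.

Definition supported n A := forall r s, ~~ in_Delta n r s -> A r s = 0.

(** The index [s] is solved from [k = i + j + s - 2 r - 1]. If the subtraction is truncated, then
    [s = 0], where a supported family vanishes. *)
Definition psi_coef A i j k : F :=
  \sum_(i <= r < j)
    (-1) ^+ (r - i) * ('C(j - r - 1, r - i))%:R * A r (k + (2 * r).+1 - (i + j))%N.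

Definition psi_const A i j k : F :=
  if (i == 0%N) || (j == 0%N) then 0
  else if (i < j)%N then psi_coef A i j k
  else if (j < i)%N then - psi_coef A j i k else 0.

Definition mu0_const i j k : F :=
  if (i == 0%N) && (0 < j)%N then (k == j.+1)%:R
  else if (j == 0%N) && (0 < i)%N then - (k == i.+1)%:R else 0.

Definition mu_const A i j k := mu0_const i j k + psi_const A i j k.

Lemma psi_coef_succ A i k : psi_coef A i i.+1 k = A i k.
Proof. by rewrite /psi_coef big_nat1 !subnn expr0 subSnn bin0 !mul1r; congr A; lia. Qed.

(** Pascal's rule for the binomial coefficients of [psi]. It expresses that [ad x_0] is a derivation
    of [psi]. *)
Lemma psi_coef_rec A i j k : (i < j)%N ->
  psi_coef A i j k = psi_coef A i.+1 j k.+1 + psi_coef A i j.+1 k.+1.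
Proof.
move=> ij; rewrite /psi_coef (big_ltn ij) big_nat_recr ?(ltnW ij) //= (big_ltn ij).
have -> : 'C(j.+1 - j - 1, j - i) = 0%N by rewrite bin_small; lia.
rewrite mulr0 mul0r addr0 [RHS]addrCA.
rewrite !subnn !bin0 !addSn !addnS !subSS; congr (_ + _).
rewrite -big_split /=; apply: eq_big_nat => r /andP[ir rj].
rewrite !subSS -mulrDl; congr (_ * _).
have -> : (j.+1 - r - 1 = (j - r - 1).+1)%N by lia.
have -> : (r - i = (r - i.+1).+1)%N by lia.
by rewrite binS natrD exprS; ring.
Qed.

Section Supported.
Variables (n : nat) (A : nat -> nat -> F).
Hypothesis supA : supported n A.

(** The binomial coefficient vanishes unless [2 r + 1 <= i + j]. The remaining parameters have
    weight [k - i - j], and weight zero occurs in [Delta] only as [2 r + 1 = n - 1] with [n] even,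
    which forces [k >= n - 1]. *)
Lemma psi_coef_small i j k : (k < i + j)%N || (k == i + j)%N && ((k < n.-1)%N || odd n) ->
  psi_coef A i j k = 0.
Proof.
move=> H; rewrite /psi_coef big1_seq // => r /andP[_]; rewrite mem_index_iota => ir.
have [ijr|rij] := ltnP (i + j) (2 * r).+1; first by rewrite bin_small ?mulr0 ?mul0r //; lia.
by rewrite supA ?mulr0 // /in_Delta; lia.
Qed.

Lemma psi_coef_out i j k : (n <= j)%N -> (k < n)%N -> psi_coef A i j k = 0.
Proof.
move=> H kn; rewrite /psi_coef big1_seq // => r /andP[_]; rewrite mem_index_iota => ir.
by rewrite supA ?mulr0 // /in_Delta; lia.
Qed.

Lemma psi_const_small i j k : (k < i + j)%N || (k == i + j)%N && ((k < n.-1)%N || odd n) ->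
  psi_const A i j k = 0.
Proof.
move=> H; rewrite /psi_const; case: ifP => // _; case: ifP => _.
  exact: psi_coef_small.
by case: ifP => // _; rewrite psi_coef_small ?oppr0 // addnC.
Qed.

Lemma psi_const_out i j k : (n <= i)%N || (n <= j)%N -> (k < n)%N ->
  psi_const A i j k = 0.
Proof.
move=> H kn; rewrite /psi_const; case: ifP => // _.
case: ltnP => ij; first by apply: psi_coef_out => //; lia.
by case: ltnP => // ji; rewrite psi_coef_out ?oppr0 //; lia.
Qed.

Lemma psi_const_anti i j k : psi_const A i j k = - psi_const A j i k.
Proof.
rewrite /psi_const orbC; case: ifP; rewrite ?oppr0 // => _.
by case: ltngtP; rewrite ?opprK ?oppr0.
Qed.

Lemma psi_const_rec i j k : (0 < i)%N -> (0 < j)%N ->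
  psi_const A i j k = psi_const A i.+1 j k.+1 + psi_const A i j.+1 k.+1.
Proof.
wlog: i j / (i <= j)%N => [hwlog i0 j0|].
  case/orP: (leq_total i j) => [/hwlog|/hwlog H]; first exact.
  by rewrite psi_const_anti H // opprD addrC -!psi_const_anti.
rewrite leq_eqVlt => /predU1P[->|ij] i0 j0.
  by rewrite psi_const_anti -(psi_const_anti j j k) [psi_const A j.+1 _ _]psi_const_anti
    /psi_const ltnn addrC subrr !if_same.
rewrite /psi_const /= !gtn_eqF //= ij (ltnW ij : (i < j.+1)%N) psi_coef_rec //.
case: (ltngtP i.+1 j) => [//|H|<-]; first by lia.
by rewrite {1}/psi_coef big_geq // add0r.
Qed.

End Supported.
End StructureConstants.

(** * Structure constants of [mu_0 + psi] *)

Section BracketConstants.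
Variables (F : comNzRingType) (n : nat) (A : nat -> nat -> F).

Lemma mu_const_anti i j k :
  mu_const A i j k = - mu_const A j i k.
Proof.
rewrite /mu_const psi_const_anti opprD; congr (_ + _); rewrite /mu0_const.
by case: i j => [|i] [|j]; rewrite /= ?oppr0 ?opprK.
Qed.

Lemma mu_const_diag i k :
  mu_const A i i k = 0.
Proof. by rewrite /mu_const /psi_const /mu0_const ltnn; case: i; rewrite /= addr0. Qed.

Lemma mu_const_small i j k :
  supported n A -> [|| k <= i, k <= j | k <= 1]%N -> mu_const A i j k = 0.
Proof.
move=> sA H; rewrite /mu_const /mu0_const.
case: i H => [|i]; case: j => [|j] H; rewrite /= ?add0r.
- by rewrite /psi_const.
- by rewrite /psi_const addr0 ltn_eqF //; lia.
- by rewrite /psi_const orbT addr0 ltn_eqF ?oppr0 //; lia.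
- by rewrite (psi_const_small sA) //; lia.
Qed.

Lemma mu_const_pos i j k : (0 < i)%N -> (0 < j)%N ->
  mu_const A i j k = psi_const A i j k.
Proof. by case: i j => [|i] [|j] // _ _; rewrite /mu_const add0r. Qed.

Lemma mu_const0 j k : (0 < j)%N -> mu_const A 0 j k = (k == j.+1)%:R.
Proof. by case: j => // j _; rewrite /mu_const /psi_const addr0. Qed.

Lemma mu_const_weight i j k : supported n A -> (0 < i)%N -> (0 < j)%N ->
  (k < i + j)%N || (k == i + j)%N && ((k < n.-1)%N || odd n) -> mu_const A i j k = 0.
Proof. by move=> sA i0 j0 H; rewrite mu_const_pos // (psi_const_small sA). Qed.

End BracketConstants.

(** * Tuples indexed by [Delta] as finitely supported families of parameters *)

Section Coordinates.
Variables (R : realType) (n : nat).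
Hypothesis n_ge4 : (4 <= n)%N.
Local Notation C := (Cplx R).

Lemma mem_Delta (p : 'I_n * 'I_n) : (p \in Delta n) = in_Delta n p.1 p.2.
Proof.
rewrite inE /in_Delta; case: p => [[r rn] [s sn]] /=.
by apply/idP/idP; move: n_ge4 rn sn; rewrite divn2; lia.
Qed.

(** Extension by zero, written as a sum over [Delta] so that the linearity of [psi] in the tuple
    becomes an exchange of sums. *)
Definition coef_of (a : coords R n) r s : C :=
  \sum_(p : {p : 'I_n * 'I_n | p \in Delta n})
    (((val p).1 == r :> nat) && ((val p).2 == s :> nat))%:R * a p.

Definition coords_of (A : nat -> nat -> C) : coords R n :=
  fun p => A (val p).1 (val p).2.

Lemma supported_coef_of a : supported n (coef_of a).
Proof.
move=> r s; apply: contraNeq => Ars; apply: contraT => rsD; case/eqP: Ars.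
rewrite /coef_of big1 // => p _; case: andP => [[/eqP rE /eqP sE]|]; last by rewrite mul0r.
by move: rsD; rewrite -rE -sE -mem_Delta (valP p).
Qed.

Lemma coef_ofE a (p : {p : 'I_n * 'I_n | p \in Delta n}) :
  coef_of a (val p).1 (val p).2 = a p.
Proof.
rewrite /coef_of (bigD1 p) //= !eqxx mul1r big1 ?addr0 // => q /eqP qp.
case: andP => [[/eqP/val_inj e1 /eqP/val_inj e2]|]; last by rewrite mul0r.
by case: qp; apply: val_inj; rewrite [val q]surjective_pairing e1 e2 -surjective_pairing.
Qed.

Lemma coords_ofK A r s : supported n A -> coef_of (coords_of A) r s = A r s.
Proof.
move=> sA; have [rsD|rsD] := boolP (in_Delta n r s); last first.
  by rewrite sA // supported_coef_of.
have [rn sn] : (r < n)%N /\ (s < n)%N by move: rsD; rewrite /in_Delta; lia.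
have pD : (Ordinal rn, Ordinal sn) \in Delta n by rewrite mem_Delta.
by have := coef_ofE (coords_of A) (exist (fun p => p \in Delta n) _ pD).
Qed.

Lemma psi_entry r s (i j k : 'I_n) : in_Delta n r s ->
  psi R n r s i j k ord0 =
  psi_const (fun r' s' => ((r == r') && (s == s'))%:R) i j k.
Proof.
move=> rsD.
have key (i' j' k' : 'I_n) : (i' < j')%N ->
   (if [&& 1 <= i', i' <= r, r < j', j' <= n - 1
         & i' + j' + s - (2 * r + 1) <= n - 1]%N
    then ((-1) ^+ (r - i') * ('C(j' - r - 1, r - i'))%:R)
           *: bvec R n (i' + j' + s - (2 * r + 1))
    else 0) k' ord0 = if i' == 0%N :> nat then 0 else
     psi_coef (fun r' s' => ((r == r') && (s == s'))%:R) i' j' k' :> C.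
  move=> ij; case: eqP => [->|/eqP i0]; first by rewrite /= mxE.
  have jn := ltn_ord j'; have kn := ltn_ord k'.
  rewrite lt0n i0 /= (_ : (j' <= n - 1)%N = true); last by lia.
  rewrite /psi_coef; case: ifP => [/and3P[ir rj sn]|H].
    rewrite (bigD1_seq r) ?iota_uniq ?mem_index_iota ?ir //= eqxx big1 ?addr0.
      rewrite !mxE; congr (_ * _%:R); move: rsD; rewrite /in_Delta; lia.
    by move=> r' /negPf; rewrite eq_sym => ->; rewrite mulr0.
  rewrite big1_seq ?mxE // => r' /andP[_]; rewrite mem_index_iota => /andP[ir rj].
  case: eqP => [rE|_]; last by rewrite mulr0.
  case: eqP => [sE|_]; last by rewrite mulr0.
  by move: rsD H; rewrite /in_Delta; lia.
rewrite /psi /alt_map /psi_const mxE.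
case: (ssrnat.ltngtP i j) => ij.
- by rewrite key //; case: eqP => //= _; rewrite gtn_eqF //; lia.
- by rewrite mxE key // orbC; case: eqP; rewrite ?oppr0 //= gtn_eqF //; lia.
- by rewrite mxE if_same.
Qed.

Lemma psi_const_sum (I : finType) (c : I -> C) (B : I -> nat -> nat -> C) i j k :
  psi_const (fun r s => \sum_p B p r s * c p) i j k = \sum_p c p * psi_const (B p) i j k.
Proof.
have H i' j' : psi_coef (fun r s => \sum_p B p r s * c p) i' j' k =
    \sum_p c p * psi_coef (B p) i' j' k.
  rewrite /psi_coef (eq_bigr _ (fun p _ => mulr_sumr _ _ _ _)) exchange_big /=.
  apply: eq_bigr => r _; rewrite mulr_sumr; apply: eq_bigr => p _; ring.
rewrite /psi_const; case: ifP => _; first by rewrite big1 // => p; rewrite mulr0.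
case: ifP => _ //; case: ifP => _; last by rewrite big1 // => p; rewrite mulr0.
by rewrite H -sumrN; apply: eq_bigr => p _; rewrite mulrN.
Qed.

Lemma psi_sum_entry a (i j k : 'I_n) :
  psi_sum a i j k ord0 = psi_const (coef_of a) i j k.
Proof.
rewrite /psi_sum mxE summxE /coef_of psi_const_sum; apply: eq_bigr => p _.
by rewrite mxE psi_entry // -mem_Delta (valP p).
Qed.

Lemma mu0_entry (i j k : 'I_n) : mu0 R n i j k ord0 = mu0_const C i j k.
Proof.
have [iN jN kN] := And3 (ltn_ord i) (ltn_ord j) (ltn_ord k).
rewrite /mu0 /alt_map /mu0_const mxE; case: (ssrnat.ltngtP i j) => ij.
- case: eqP => i0 /=; last by rewrite mxE gtn_eqF //; lia.
  rewrite i0 in ij; rewrite ij /=; case: ifP => H; rewrite !mxE //.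
  by rewrite ltn_eqF //; lia.
- rewrite mxE; case: eqP => j0 /=; last first.
    by rewrite mxE oppr0 gtn_eqF //; lia.
  rewrite j0 in ij; rewrite ij gtn_eqF //=; case: ifP => H; rewrite !mxE //.
  by rewrite ltn_eqF //; lia.
- by rewrite mxE ij; case: eqP => // ->.
Qed.

Lemma bracket_of_entry a (i j k : 'I_n) :
  bracket_of a i j k ord0 = mu_const (coef_of a) i j k.
Proof.
by rewrite /bracket_of /mu_const -psi_sum_entry -mu0_entry [X in fun_of_matrix X]mxE [LHS]mxE.
Qed.

End Coordinates.

(** * The Jacobi identity in structure constants *)

Section JacobiConstants.
Variable F : comNzRingType.
Implicit Types (K : nat -> nat -> nat -> F) (n i j k l m : nat).

Definition jac n K i j k l : F :=
  \sum_(m < n) (K i j m * K m k l + K j k m * K m i l + K k i m * K m j l).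

Lemma jac_cycle n K i j k l : jac n K i j k l = jac n K j k i l.
Proof. by apply: eq_bigr => m _; rewrite [RHS]addrC addrA. Qed.

Lemma jac_anti n K i j k l : (forall i j k, K i j k = - K j i k) ->
  jac n K i j k l = - jac n K j i k l.
Proof.
move=> Kanti; rewrite -sumrN; apply: eq_bigr => m _.
by rewrite (Kanti i j) (Kanti j k) (Kanti k i); ring.
Qed.

(** On a triple containing [x_0] the left side vanishes because [ad x_0] is a derivation of [psi],
    and the right side because [psi] kills [x_0]. On other triples [mu_0] does not contribute, since
    the values of [psi] have no component on [x_0]. Thus the equations of [F^n], stated for [psi],
    are the Jacobi identity of the whole bracket. *)
Lemma jac_mu_psi n A i j k l : supported n A ->
  (i < n)%N -> (j < n)%N -> (k < n)%N -> (l < n)%N ->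
  jac n (mu_const A) i j k l = jac n (psi_const A) i j k l.
Proof.
move=> sA.
have mu_anti := mu_const_anti A.
have psi0l j' k' : psi_const A 0 j' k' = 0 by [].
have psi0r j' k' : psi_const A j' 0 k' = 0 by rewrite /psi_const orbT.
have psi00 i' j' : psi_const A i'.+1 j'.+1 0 = 0 by rewrite (psi_const_small sA).
have mu_pos i' j' m : mu_const A i'.+1 j'.+1 m = psi_const A i'.+1 j'.+1 m.
  by rewrite /mu_const /mu0_const /= add0r.
have mu00 m : mu_const A 0 0 m = 0 by rewrite /mu_const /mu0_const /= psi0l addr0.
have case0 j' k' : (j' < n)%N -> (k' < n)%N -> (l < n)%N ->
    jac n (mu_const A) 0 j' k' l = 0.
  case: j' => [|j'].
    by move=> *; apply: big1 => m _; rewrite mu00 (mu_anti k' 0%N); ring.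
  case: k' => [|k'] jn kn ln.
    by apply: big1 => m _; rewrite mu00 (mu_anti j'.+1 0%N); ring.
  have sum_shift i' j'' : (i' < n)%N ->
      \sum_(m < n) (nat_of_ord m == i'.+1)%:R * mu_const A m j''.+1 l = psi_const A i'.+1 j''.+1 l.
    move=> i'n; have [i'1n|ni'] := ltnP i'.+1 n; last first.
      rewrite (psi_const_out sA) ?ni' // big1 // => m _.
      by rewrite ltn_eqF ?mul0r //; apply: leq_trans ni'.
    rewrite (bigD1 (Ordinal i'1n)) //= eqxx mul1r big1 ?addr0 ?mu_pos // => m.
    by rewrite -val_eqE /= => /negPf ->; rewrite mul0r.
  rewrite /jac !big_split /=.
  under eq_bigr do rewrite /mu_const psi0l addr0 /mu0_const /= -/(mu_const A _ k'.+1 l).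
  rewrite sum_shift //.
  under [X in _ + X]eq_bigr do
    rewrite {1}/mu_const psi0r addr0 /mu0_const /= mulNr -/(mu_const A _ j'.+1 l).
  rewrite sumrN sum_shift //.
  rewrite (_ : \sum_(i < n) _ = - psi_const A j'.+1 k'.+1 l.-1); last first.
    case: l ln {sum_shift} => [|l'] ln.
      rewrite psi00 oppr0 big1 // => m _; rewrite mu_pos.
      case: m => [[|m] mn] /=; first by rewrite psi00 mul0r.
      by rewrite /mu_const psi0r /mu0_const /= oppr0 addr0 mulr0.
    rewrite (bigD1 (Ordinal (ltnW ln))) //= mu_pos big1 ?addr0 => [|m].
      case: l' ln => [|l'] ln; first by rewrite !psi00 mul0r oppr0.
      by rewrite /mu_const psi0r /mu0_const /= eqxx addr0 mulrN1.
    rewrite -val_eqE /= mu_pos; case: m => [[|m] mn] /= H; first by rewrite psi00 mul0r.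
    by rewrite /mu_const psi0r /mu0_const /= eqSS eq_sym (negPf H) oppr0 addr0 mulr0.
  case: l ln {sum_shift} => [|l'] ln; first by rewrite !psi00; ring.
  rewrite /= (psi_const_rec A l' (ltn0Sn j') (ltn0Sn k')).
  by rewrite [psi_const A k'.+2 _ _]psi_const_anti; ring.
case: i => [|i] iN jN kN lN.
  rewrite case0 // /jac big1 // => m _; rewrite psi0l psi0r mul0r.
  by rewrite psi0r mulr0 mul0r !addr0.
case: j jN => [|j] jN.
  rewrite jac_cycle case0 // /jac big1 // => m _; rewrite psi0l !psi0r !mul0r.
  by rewrite mulr0 !addr0.
case: k kN => [|k] kN.
  rewrite -jac_cycle case0 // /jac big1 // => m _; rewrite psi0l !psi0r !mul0r.
  by rewrite mulr0 !addr0.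
apply: eq_bigr => m _; rewrite !mu_pos.
case: m => [[|m] mn] /=; first by rewrite !psi00 !mul0r.
by rewrite !mu_pos.
Qed.

End JacobiConstants.

(** * Coordinates of brackets and the lower central series *)

Section Filiform.
Variables (R : realType) (n : nat).
Local Notation C := (Cplx R).
Local Notation V := 'cV[C]_n.

Lemma br_entry (mu : bilmap R n) x y l :
  br mu x y l ord0 = \sum_(i < n) \sum_(j < n) x i ord0 * y j ord0 * mu i j l ord0.
Proof.
rewrite /br summxE; apply: eq_bigr => i _; rewrite summxE.
by apply: eq_bigr => j _; rewrite mxE.
Qed.

Lemma br_delta_entry (mu : bilmap R n) x (k l : 'I_n) :
  br mu x (delta_mx k ord0) l ord0 = \sum_(m < n) x m ord0 * mu m k l ord0.
Proof.
rewrite br_entry; apply: eq_bigr => m _; rewrite (bigD1 k) //= mxE !eqxx mulr1.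
rewrite big1 ?addr0 // => j /negPf jk; by rewrite mxE jk mulr0 mul0r.
Qed.

Lemma jacobi_const (mu : bilmap R n) (K : nat -> nat -> nat -> C) :
  (forall i j k : 'I_n, mu i j k ord0 = K i j k) ->
  jacobi mu <-> (forall i j k l : 'I_n, jac n K i j k l = 0).
Proof.
move=> muK.
have E (i j k l : 'I_n) : (br mu (mu i j) (delta_mx k ord0) +
    br mu (mu j k) (delta_mx i ord0) + br mu (mu k i) (delta_mx j ord0)) l ord0
    = jac n K i j k l.
  rewrite !mxE !br_delta_entry -!big_split; apply: eq_bigr => m _ /=.
  by rewrite !muK.
split=> [jacm i j k l|jacK].
  by rewrite -E -!br_delta jacm mxE.
by apply: jacobi_delta => i j k; apply/colP => l; rewrite E jacK mxE.
Qed.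

Section Lcs.
Variable mu : bilmap R n.

Lemma lcs_br k x y : y \in lcs mu k -> br mu x y \in lcs mu k.+1.
Proof.
move=> yk; rewrite (coord_vbasis (memvf x)) (coord_vbasis yk) br_suml.
apply: rpred_sum => i _; rewrite br_sumr; apply: rpred_sum => j _.
rewrite brZl brZr; do 2![apply: rpredZ]; apply: memv_span; apply/allpairsP.
exists ((vbasis {:V})`_i, (vbasis (lcs mu k))`_j); split=> //; by rewrite mem_nth // size_tuple.
Qed.

Lemma lcs_sub k (U : {vspace V}) :
  (forall x y, y \in lcs mu k -> br mu x y \in U) -> (lcs mu k.+1 <= U)%VS.
Proof.
move=> H; apply/span_subvP => _ /allpairsP[[x y] [_ yk ->]].
by apply: H; apply: vbasis_mem.
Qed.

Lemma lcs_ind k (P : V -> Prop) :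
  P 0 -> (forall c x y, P x -> P y -> P (c *: x + y)) ->
  (forall x y, y \in lcs mu k -> P (br mu x y)) ->
  forall x, x \in lcs mu k.+1 -> P x.
Proof.
move=> P0 Plin Pbr x /=; set s := (X in <<X>>%VS) => xs.
rewrite (@coord_span _ _ _ (in_tuple s) _ xs).
elim/big_ind: _ => // [y z|i _]; first by move=> Py; rewrite -[y]scale1r; apply: Plin.
rewrite -[_ *: _]addr0; apply: Plin => //.
have /allpairsP[[u v] [_ vk ->]] : (in_tuple s)`_i \in s by rewrite mem_nth.
by apply: Pbr; apply: vbasis_mem.
Qed.

End Lcs.

End Filiform.

(** * The points of [F^n] are filiform Lie brackets *)

Section BracketOf.
Variables (R : realType) (n : nat).
Hypothesis n_ge4 : (4 <= n)%N.
Local Notation C := (Cplx R).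
Local Notation V := 'cV[C]_n.

Lemma Fvar_jac (a : coords R n) : Fvar a <->
  forall i j k l : 'I_n, jac n (psi_const (coef_of a)) i j k l = 0.
Proof. exact/jacobi_const/psi_sum_entry. Qed.

Lemma lie_bracket_of (a : coords R n) : Fvar a <-> lie_variety (bracket_of a).
Proof.
have entry := bracket_of_entry n_ge4 a.
have sA := supported_coef_of n_ge4 a.
split=> [/Fvar_jac Fa|[_ /(jacobi_const entry) jacm]]; last first.
  by apply/Fvar_jac => i j k l; rewrite -jac_mu_psi.
split; last by apply/(jacobi_const entry) => i j k l; rewrite jac_mu_psi.
apply: alt_of_delta => [i j|i]; apply/colP => k.
  by rewrite [RHS]mxE !entry mu_const_anti.
by rewrite entry mu_const_diag mxE.
Qed.

(** The first step of the series gains two indices, because no bracket has a component on [x_0] or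
    [x_1]; each later step gains one. With the next lemma, term [k >= 1] of the series is the span
    of the [x_j] with [j > k]. *)
Lemma lcs_bracket_of_small (a : coords R n) k (l : 'I_n) v :
  v \in lcs (bracket_of a) k.+1 -> (l <= k.+1)%N -> v l ord0 = 0.
Proof.
move=> vk lk; have sA := supported_coef_of n_ge4 a.
elim: k v l vk lk => [|k IH] v l vk; move: l.
  elim/lcs_ind: vk => [l _|c x y Px Py l ln|x y _ l ln].
  - by rewrite mxE.
  - by rewrite !mxE Px // Py // mulr0 addr0.
  - rewrite br_entry big1 // => i _; rewrite big1 // => j _.
    by rewrite bracket_of_entry // (mu_const_small sA) ?mulr0 // ln !orbT.
elim/lcs_ind: vk => [l _|c x y Px Py l ln|x y yk l ln].
- by rewrite mxE.
- by rewrite !mxE Px // Py // mulr0 addr0.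
- rewrite br_entry big1 // => i _; rewrite big1 // => j _.
  have [jk|kj] := leqP j k.+1; first by rewrite (IH y) // mulr0 mul0r.
  by rewrite bracket_of_entry // (mu_const_small sA) ?mulr0 // (leq_trans ln kj) orbT.
Qed.

Lemma delta_lcs_bracket_of (a : coords R n) k (j : 'I_n) :
  (k < j)%N -> (delta_mx j ord0 : V) \in lcs (bracket_of a) k.
Proof.
elim: k j => [|k IH] j kj; first exact: memvf.
have j0 : (0 < n)%N by lia.
have j1 : (j.-1 < n)%N by rewrite (leq_ltn_trans (leq_pred _)).
have -> : delta_mx j ord0 = br (bracket_of a) (delta_mx (Ordinal j0) ord0)
    (delta_mx (Ordinal j1) ord0).
  rewrite br_delta; apply/colP => l; rewrite bracket_of_entry // mxE eqxx andbT.
  rewrite /mu_const /psi_const /mu0_const /= addr0 (_ : (0 < j.-1)%N); last by lia.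
  by rewrite prednK ?(leq_trans _ kj) // eq_sym.
by apply: lcs_br; apply: IH => /=; lia.
Qed.

Lemma filiform_bracket_of (a : coords R n) : Fvar a -> filiform (bracket_of a).
Proof.
move=> Fa; split; first exact/lie_bracket_of.
split=> [|k kn].
  apply/eqP; rewrite -subv0; apply/subvP => v vk; rewrite memv0; apply/eqP.
  apply/colP => l; rewrite mxE.
  apply: (@lcs_bracket_of_small a n.-2 l); last by have := ltn_ord l; lia.
  by rewrite (_ : n.-2.+1 = n.-1) //; lia.
have k1 : (k.+1 < n)%N by lia.
move=> L0; have := delta_lcs_bracket_of a (ltnSn k : k < Ordinal k1)%N.
rewrite L0 memv0 => /eqP/colP/(_ (Ordinal k1)); rewrite !mxE !eqxx => /eqP.
by rewrite oner_eq0.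
Qed.

End BracketOf.

(** * The Jacobi identity as explicit quadratic equations *)

Section JacobiEquations.
Variable F : comNzRingType.
Implicit Types (A : nat -> nat -> F) (n i j k l : nat).

(* Signed monomials of the structure constants and of the Jacobi identity, as closed data
   that can be computed for given indices. *)
Definition psi_coef_terms n b i j k : seq (bool * nat * (nat * nat)) :=
  [seq (b (+) odd (r - i), 'C(j - r - 1, r - i), (r, k + (2 * r).+1 - (i + j)))%N
     | r <- index_iota i j
     & in_Delta n r (k + (2 * r).+1 - (i + j)) && ('C(j - r - 1, r - i) != 0)%N].

Definition psi_terms n i j k :=
  if (i == 0%N) || (j == 0%N) then [::]
  else if (i < j)%N then psi_coef_terms n false i j k
  else if (j < i)%N then psi_coef_terms n true j i k else [::].

Definition mul_terms (T : Type) (s t : seq (bool * nat * T)) :=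
  [seq (u.1.1 (+) v.1.1, (u.1.2 * v.1.2)%N, (u.2, v.2)) | u <- s, v <- t].

Definition jac_terms n i j k l :=
  flatten [seq mul_terms (psi_terms n i j m) (psi_terms n m k l)
            ++ mul_terms (psi_terms n j k m) (psi_terms n m i l)
            ++ mul_terms (psi_terms n k i m) (psi_terms n m j l) | m <- iota 0 n].

Lemma psi_termsE n A i j k : supported n A -> psi_const A i j k =
  \sum_(t <- psi_terms n i j k) (-1) ^+ t.1.1 * t.1.2%:R * A t.2.1 t.2.2.
Proof.
move=> sA.
have coefE b i' j' : \sum_(t <- psi_coef_terms n b i' j' k)
    (-1) ^+ t.1.1 * t.1.2%:R * A t.2.1 t.2.2 = (-1) ^+ b * psi_coef A i' j' k.
  rewrite big_map big_filter big_mkcond /psi_coef mulr_sumr; apply: eq_bigr => r _ /=.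
  case: andP => [_|/andP]; first by rewrite signr_addb signr_odd !mulrA.
  by rewrite negb_and negbK => /orP[/sA->|/eqP->]; rewrite ?(mulr0, mul0r).
rewrite /psi_const /psi_terms; case: ifP => _; first by rewrite big_nil.
case: ifP => _; first by rewrite coefE expr0 mul1r.
by case: ifP => _; rewrite ?big_nil // coefE expr1 mulN1r.
Qed.

Lemma jac_termsE n A i j k l : supported n A -> jac n (psi_const A) i j k l =
  \sum_(t <- jac_terms n i j k l)
     (-1) ^+ t.1.1 * t.1.2%:R * (A t.2.1.1 t.2.1.2 * A t.2.2.1 t.2.2.2).
Proof.
move=> sA; pose P := psi_const A.
transitivity (\sum_(0 <= m < n) (P i j m * P m k l + P j k m * P m i l + P k i m * P m j l)).
  by rewrite big_mkord.
rewrite /jac_terms big_flatten big_map /index_iota subn0.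
have mulE i' j' k' l' m : psi_const A i' j' m * psi_const A m k' l' =
    \sum_(t <- mul_terms (psi_terms n i' j' m) (psi_terms n m k' l'))
     (-1) ^+ t.1.1 * t.1.2%:R * (A t.2.1.1 t.2.1.2 * A t.2.2.1 t.2.2.2).
  rewrite !(psi_termsE _ _ _ sA) big_allpairs_dep mulr_suml; apply: eq_bigr => u _.
  rewrite mulr_sumr; apply: eq_bigr => v _.
  by rewrite signr_addb natrM; ring.
by apply: eq_bigr => m _; rewrite !big_cat /= -!mulE addrA.
Qed.

Lemma jac_psi_sorted n A : supported n A ->
  (forall i j k l, (0 < i)%N -> (i < j)%N -> (j < k)%N -> (k < n)%N -> (l < n)%N ->
     jac n (psi_const A) i j k l = 0) ->
  forall i j k l : 'I_n, jac n (psi_const A) i j k l = 0.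
Proof.
move=> sA H i j k l; move: (ltn_ord i) (ltn_ord j) (ltn_ord k) (ltn_ord l).
move: (nat_of_ord i) (nat_of_ord j) (nat_of_ord k) (nat_of_ord l) => {}i {}j {}k {}l.
have anti := @psi_const_anti F A.
have diag i' k' : jac n (psi_const A) i' i' k' l = 0.
  apply: big1 => m _; rewrite (anti k') [psi_const A i' i' m](_ : _ = 0); first ring.
  by rewrite /psi_const ltnn !if_same.
have zero j' k' : jac n (psi_const A) 0 j' k' l = 0.
  have r0 i' m : psi_const A i' 0 m = 0 by rewrite /psi_const orbT.
  by apply: big1 => m _; rewrite !r0 (anti 0%N) r0 oppr0 mulr0 !mul0r !addr0.
have [->|i0] := posnP i; first by move=> *; apply: zero.
have [->|j0] := posnP j; first by move=> *; rewrite jac_cycle zero.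
have [->|k0] := posnP k; first by move=> *; rewrite -jac_cycle zero.
wlog ij : i j i0 j0 / (i < j)%N => [hw|] iN jN kN lN.
  case: (ssrnat.ltngtP i j) => [ij|ji|->]; [exact: hw| |exact: diag].
  by rewrite jac_anti // hw ?oppr0.
case: (ssrnat.ltngtP j k) => [jk|kj|<-].
- exact: H.
- case: (ssrnat.ltngtP i k) => [ik|ki|<-].
  + by rewrite jac_cycle jac_anti // jac_cycle jac_cycle H ?oppr0.
  + by rewrite -jac_cycle H.
  + by rewrite -jac_cycle diag.
- by rewrite jac_cycle diag.
Qed.

(* A product of two structure constants raises the weight by at least two, except that
   [psi] has a part of weight zero when [n] is even, which takes values in the centre. *)
Lemma jac_psi_small n A i j k l : supported n A -> (l < n)%N ->
  (l <= i + j + k)%N || (l == (i + j + k).+1) && ((l < n.-1)%N || odd n) ->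
  jac n (psi_const A) i j k l = 0.
Proof.
move=> sA ln H.
suff zero i' j' k' m : (m < n)%N -> (i' + j' + k' = i + j + k)%N ->
    psi_const A i' j' m * psi_const A m k' l = 0.
  by apply: big1 => m _; rewrite !zero ?addr0 //; lia.
move=> mn E.
have [i0|i0] := posnP i'; first by rewrite i0 mul0r.
have [j0|j0] := posnP j'; first by rewrite j0 {1}/psi_const orbT mul0r.
have [k0|k0] := posnP k'; first by rewrite k0 {2}/psi_const orbT mulr0.
have [H1|H1] := boolP ((m < i' + j')%N || (m == i' + j')%N && ((m < n.-1)%N || odd n)).
  by rewrite (psi_const_small sA H1) mul0r.
by rewrite (psi_const_small (i := m) sA) ?mulr0 //; lia.
Qed.

End JacobiEquations.

(** * The equations of [F^9], [F^10] and [F^11] *)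

Section JacobiLowDimension.
Variable F : comNzRingType.
Implicit Types A : nat -> nat -> F.

(* The coefficients of [x_8], [x_9] and [x_10] in the Jacobi identity for [x_1, x_2, x_3]. *)
Definition quad8 A := 3 * A 2 6 ^+ 2 - A 3 8 * (2 * A 1 4 + A 2 6).

Definition quad9 A := 7 * A 2 6 * A 2 7 - A 3 9 * (2 * A 1 4 + A 2 6)
  - 3 * A 3 8 * (A 1 5 + A 2 7) + A 4 9 * (2 * A 1 6 + A 2 8).

Definition quad10 A := 8 * A 2 6 * A 2 8 - A 3 10 * (2 * A 1 4 + A 2 6)
  - 2 * A 3 8 * (2 * A 1 6 + 3 * A 2 8) + A 4 10 * (2 * A 1 6 + A 2 8)
  + 4 * A 2 7 ^+ 2 - 3 * A 3 9 * (A 1 5 + A 2 7).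

Ltac jac_eval sA := rewrite (jac_termsE _ _ _ _ sA);
  match goal with |- context [jac_terms ?n ?i ?j ?k ?l] =>
    let t := eval vm_compute in (jac_terms n i j k l) in
    change (jac_terms n i j k l) with t end;
  rewrite !big_cons big_nil /=.

(** Since [i + j + k >= 6], weight at least two leaves a single coefficient. *)
Lemma jac_psi9 A : supported 9 A ->
  (forall i j k l : 'I_9, jac 9 (psi_const A) i j k l = 0) <-> quad8 A = 0.
Proof.
move=> sA.
have E8 : jac 9 (psi_const A) 1 2 3 8 = quad8 A by jac_eval sA; rewrite /quad8; ring.
split=> [J|H].
  by rewrite -E8; have := J (inord 1) (inord 2) (inord 3) (inord 8); rewrite !inordK.
apply: jac_psi_sorted => // i j k l i0 ij jk kn ln.
have [H'|H'] := leqP l (i + j + k).+1; first by apply: jac_psi_small => //; lia.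
have [-> [-> [-> ->]]] : (i = 1 /\ j = 2 /\ k = 3 /\ l = 8)%N by lia.
by rewrite E8.
Qed.

(** The weight zero part of [psi] adds the coefficients of [x_9] of weight one, on [(x_1, x_2, x_5)]
    and [(x_1, x_3, x_4)]. They are the source of the equation with the factor [A 4 9]. *)
Lemma jac_psi10 A : supported 10 A ->
  (forall i j k l : 'I_10, jac 10 (psi_const A) i j k l = 0) <->
  [/\ quad8 A = 0, quad9 A = 0 & A 4 9 * (2 * A 1 4 - A 2 6 - A 3 8) = 0].
Proof.
move=> sA.
have E8 : jac 10 (psi_const A) 1 2 3 8 = quad8 A by jac_eval sA; rewrite /quad8; ring.
have E9 : jac 10 (psi_const A) 1 2 3 9 = quad9 A by jac_eval sA; rewrite /quad9; ring.
have E9' : jac 10 (psi_const A) 1 2 5 9 = A 4 9 * (2 * A 1 4 - A 2 6 - A 3 8).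
  by jac_eval sA; ring.
split=> [J|[H8 H9 H9']].
  split; rewrite -?E8 -?E9 -?E9'.
  - by have := J (inord 1) (inord 2) (inord 3) (inord 8); rewrite !inordK.
  - by have := J (inord 1) (inord 2) (inord 3) (inord 9); rewrite !inordK.
  - by have := J (inord 1) (inord 2) (inord 5) (inord 9); rewrite !inordK.
apply: jac_psi_sorted => // i j k l i0 ij jk kn ln.
have [H'|H'] := boolP ((l <= i + j + k)%N || (l == (i + j + k).+1) && (l < 9)%N).
  by apply: jac_psi_small => //; lia.
have i1 : i = 1%N by lia.
have [j2|[j3 k4 l9]] : j = 2%N \/ [/\ j = 3, k = 4 & l = 9]%N.
  by case: (eqVneq j 2%N) => ?; [left|right; split; lia].
  rewrite i1 j2 in H' *.
  have [k3|k3] := eqVneq k 3%N.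
    have [-> | ->] : (l = 8 \/ l = 9)%N by lia.
      by rewrite k3 E8.
    by rewrite k3 E9.
  have l9 : l = 9%N by lia.
  have [->|->] : (k = 4 \/ k = 5)%N by lia.
    (* [ad x_0] is a derivation of the Jacobi expression too: the coefficient of [x_8] on (1, 2, 3)
       is that of [x_9] on (1, 2, 4), as (2, 2, 3) and (1, 3, 3) contribute nothing. *)
    by rewrite l9 -[RHS]H8; jac_eval sA; rewrite /quad8; ring.
  by rewrite l9 E9'.
(* By the same derivation applied to (1, 2, 4), whose coefficient of [x_8] vanishes, the
   coefficients on (1, 3, 4) and (1, 2, 5) are opposite. *)
by rewrite i1 j3 k4 l9 -[RHS]oppr0 -[in RHS]H9'; jac_eval sA; ring.
Qed.

Lemma jac_psi11 A : supported 11 A ->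
  (forall i j k l : 'I_11, jac 11 (psi_const A) i j k l = 0) <->
  [/\ quad8 A = 0, quad9 A = 0, quad10 A = 0 &
      A 4 10 * (2 * A 1 4 - A 2 6 - A 3 8) = 4 * A 2 6 * A 3 8 - 6 * A 3 8 ^+ 2].
Proof.
move=> sA; have A49 : A 4 9 = 0 by apply: sA.
have E8 : jac 11 (psi_const A) 1 2 3 8 = quad8 A by jac_eval sA; rewrite /quad8; ring.
have E9 : jac 11 (psi_const A) 1 2 3 9 = quad9 A.
  by jac_eval sA; rewrite /quad9 A49; ring.
have E10 : jac 11 (psi_const A) 1 2 3 10 = quad10 A by jac_eval sA; rewrite /quad10; ring.
have E10' : jac 11 (psi_const A) 1 3 4 10 =
    4 * A 2 6 * A 3 8 - 6 * A 3 8 ^+ 2 - A 4 10 * (2 * A 1 4 - A 2 6 - A 3 8).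
  by jac_eval sA; ring.
split=> [J|[H8 H9 H10 H10']].
  split; [rewrite -E8|rewrite -E9|rewrite -E10|apply/esym/eqP; rewrite -subr_eq0 -E10'; apply/eqP].
  - by have := J (inord 1) (inord 2) (inord 3) (inord 8); rewrite !inordK.
  - by have := J (inord 1) (inord 2) (inord 3) (inord 9); rewrite !inordK.
  - by have := J (inord 1) (inord 2) (inord 3) (inord 10); rewrite !inordK.
  - by have := J (inord 1) (inord 3) (inord 4) (inord 10); rewrite !inordK.
apply: jac_psi_sorted => // i j k l i0 ij jk kn ln.
have [H'|H'] := leqP l (i + j + k).+1; first by apply: jac_psi_small => //; lia.
have i1 : i = 1%N by lia.
move/eqP: H10'; rewrite eq_sym -subr_eq0 => /eqP H10'.
have [j2|[j3 k4 l10]] : j = 2%N \/ [/\ j = 3, k = 4 & l = 10]%N.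
  by case: (eqVneq j 2%N) => ?; [left|right; split; lia].
  rewrite i1 j2 in H' *.
  have [k3|k3] := eqVneq k 3%N.
    rewrite k3; have [-> | [-> | ->]] : (l = 8 \/ l = 9 \/ l = 10)%N by lia.
    - by rewrite E8.
    - by rewrite E9.
    - by rewrite E10.
  have [k4|k4] := eqVneq k 4%N.
    rewrite k4; have [->|->] : (l = 9 \/ l = 10)%N by lia.
      by rewrite -[RHS]H8; jac_eval sA; rewrite /quad8; ring.
    by rewrite -[RHS]H9; jac_eval sA; rewrite /quad9 A49; ring.
  have [-> ->] : (k = 5 /\ l = 10)%N by lia.
  (* The coefficient of [x_9] on (1, 2, 4), equal to [quad8 A], is the sum of the coefficients of
     [x_10] on (1, 3, 4) and (1, 2, 5). *)
  rewrite -[RHS](subrr 0) -[in X in X - _]H8 -[in X in _ - X]H10'.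
  by jac_eval sA; rewrite /quad8; ring.
by rewrite i1 j3 k4 l10 E10'.
Qed.

End JacobiLowDimension.

(* [al], [be] and [ga] stand for the entries [g_00], [g_11] and [g_10] of the matrix of an
   isomorphism. *)
Definition iso_relation (F : fieldType) n (A B : nat -> nat -> F) := exists al be ga : F,
  [/\ al != 0, be != 0,
      al ^+ 2 * A 1 4 = be * B 1 4 /\ al ^+ 2 * A 2 6 = be * B 2 6,
      al ^+ 4 * A 1 5 = be * (al * B 1 5 - 2 * ga * B 1 4 ^+ 2) /\
      al ^+ 4 * A 2 7 = be * (al * B 2 7 + 3 * ga * (B 2 6 ^+ 2 - B 1 4 * B 2 6))
    & mu_const A 1 n.-2 n.-1 * (al + ga * mu_const B 1 n.-2 n.-1)
      = be * mu_const B 1 n.-2 n.-1].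

(** * The matrix of an isomorphism, compared in the lowest weights *)

Section Invariants.
Variables (F : fieldType) (n : nat) (A B G : nat -> nat -> F).
Hypotheses (n_ge9 : (9 <= n)%N) (sA : supported n A) (sB : supported n B).

(** Column [j] of [G] holds the image of [x_j], so [homG] below says that [G] carries the bracket of
    [A] to that of [B]. Of the invertibility of [G] only the nonzero last column is kept. *)
Definition transformed i j l :=
  \sum_(p < n) \sum_(q < n) G p i * G q j * mu_const B p q l.

Hypothesis homG : forall i j l, (i < n)%N -> (j < n)%N -> (l < n)%N ->
  \sum_(m < n) mu_const A i j m * G l m = transformed i j l.
Hypothesis G_last : (forall l, (l < n)%N -> G l n.-1 = 0) -> False.

Lemma sum_only1 (f : nat -> F) i : (i < n)%N ->
  (forall p, (p < n)%N -> p <> i -> f p = 0) -> \sum_(p < n) f p = f i.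
Proof.
move=> iN f0; rewrite (bigD1 (Ordinal iN)) //= big1 ?addr0 // => p pi.
by apply: f0 => // pE; case/eqP: pi; apply: val_inj.
Qed.

Lemma sum_only2 (f : nat -> F) i j : (i < n)%N -> (j < n)%N -> i <> j ->
  (forall p, (p < n)%N -> p <> i -> p <> j -> f p = 0) ->
  \sum_(p < n) f p = f i + f j.
Proof.
move=> iN jN ij f0; rewrite (bigD1 (Ordinal iN)) //= (bigD1 (Ordinal jN)) /=; last first.
  by rewrite -val_eqE /=; apply/eqP => /esym.
rewrite big1 ?addr0 // => p /andP[pi pj].
by apply: f0 => // pE; [case/eqP: pi|case/eqP: pj]; apply: val_inj.
Qed.

Lemma hom_ad0 j l : (0 < j)%N -> (j.+1 < n)%N -> (l < n)%N ->
  G l j.+1 = transformed 0 j l.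
Proof.
move=> j0 jn ln; rewrite -homG //; [|lia|lia].
rewrite (sum_only1 (f := fun m => mu_const A 0 j m * G l m) jn) => [|m mn mj].
  by rewrite mu_const0 // eqxx mul1r.
by rewrite mu_const0 //; case: eqP => // _; rewrite mul0r.
Qed.

Lemma G_lower j l : (2 <= j)%N -> (j < n)%N -> (l < j)%N -> G l j = 0.
Proof.
elim: j l => // j IH l j1 jn lj; rewrite hom_ad0 //; last by lia.
rewrite /transformed big1 // => p _; rewrite big1 // => q _.
have [qj|jq] := ltnP q j; last by rewrite (mu_const_small sB) ?mulr0 //; lia.
have [j2|j2] := leqP 2 j; first by rewrite IH ?mulr0 ?mul0r //; lia.
by rewrite (mu_const_small sB) ?mulr0 //; lia.
Qed.

(** The term with [G 1 0] comes from the weight zero part of [psi]: it can differ from zero only for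
    [n] even and [j = n - 2]. *)
Lemma G_diag_succ_ge2 j : (2 <= j)%N -> (j.+1 < n)%N ->
  G j.+1 j.+1 = (G 0 0 + G 1 0 * mu_const B 1 j j.+1) * G j j.
Proof.
move=> j2 jn; rewrite hom_ad0 //; last by lia.
have inner p : (p < n)%N -> \sum_(q < n) G p 0 * G q j * mu_const B p q j.+1 =
    G p 0 * G j j * mu_const B p j j.+1.
  move=> pn; apply: (sum_only1 (f := fun q => G p 0 * G q j * mu_const B p q j.+1)); first lia.
  move=> q qn qj; have [lt|ge] := ltnP q j.
    by rewrite (G_lower j2 _ lt) ?mulr0 ?mul0r //; lia.
  by rewrite (mu_const_small sB) ?mulr0 //; lia.
rewrite /transformed (eq_bigr _ (fun (p : 'I_n) _ => inner p (ltn_ord p))).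
rewrite (sum_only2 (f := fun p => G p 0 * G j j * mu_const B p j j.+1)
  (i := 0) (j := 1)) //; [|lia|lia|].
  by rewrite mu_const0 ?eqxx /=; [ring|lia].
move=> p pn p0 p1; rewrite (mu_const_weight sB) ?mulr0 //; lia.
Qed.

Lemma mu_const1_succ j : (0 < j)%N -> (j.+2 < n)%N -> mu_const B 1 j j.+1 = 0.
Proof. by move=> j0 jn; rewrite (mu_const_weight sB) //; lia. Qed.

(** The last column has only its diagonal entry, which is therefore nonzero, and the diagonal
    recursion exhibits it as a multiple of [G 0 0 ^+ (n - 4) * G 2 2]. *)
Lemma G00_G22_neq0 : G 0 0 != 0 /\ G 2 2 != 0.
Proof.
have diag k : (k.+3 < n)%N -> G k.+2 k.+2 = G 0 0 ^+ k * G 2 2.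
  elim: k => [|k IH] kn; first by rewrite mul1r.
  rewrite G_diag_succ_ge2; [|by []|lia].
  by rewrite mu_const1_succ // mulr0 addr0 IH ?exprS ?mulrA //; lia.
have last_neq0 : G n.-1 n.-1 != 0.
  apply/eqP => G0; apply: G_last => l ln; have [lt|ge] := ltnP l n.-1.
    by rewrite G_lower //; lia.
  by rewrite (_ : l = n.-1) //; lia.
move: last_neq0; have -> : n.-1 = (n - 4).+3 by lia.
rewrite G_diag_succ_ge2; [|lia|lia]; rewrite diag; last by lia.
rewrite !mulf_eq0 !negb_or expf_eq0 negb_and => /andP[_ /andP[H ->]].
split=> //; move: H; rewrite lt0n negbK; case/orP=> // /eqP; lia.
Qed.

(** [[x_1, x_2]] starts at [x_4], so its image has no component on [x_3]; but that component is
    [G 0 1 * G 2 2]. *)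
Lemma G01_eq0 : G 0 1 = 0.
Proof.
have /eqP G22 : G 2 2 <> 0 by apply/eqP; case: G00_G22_neq0.
have : \sum_(m < n) mu_const A 1 2 m * G 3 m = 0.
  apply: big1 => m _; have [m3|m3] := leqP m 3.
    by rewrite (mu_const_weight sA) ?mul0r //; lia.
  by rewrite G_lower ?mulr0 //; lia.
rewrite homG; [|lia|lia|lia]; rewrite /transformed.
rewrite (sum_only1 (f := fun p => \sum_(q < n) G p 1 * G q 2 * mu_const B p q 3) (i := 0)); [|lia|].
  rewrite (sum_only1 (f := fun q => G 0 1 * G q 2 * mu_const B 0 q 3) (i := 2)); [|lia|].
    by rewrite mu_const0 // mulr1 => /eqP; rewrite mulf_eq0 (negPf G22) orbF => /eqP.
  move=> q qn q2; have [->|q0] := eqVneq q 0%N; first by rewrite mu_const_diag mulr0.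
  by rewrite mu_const0 ?lt0n //; case: eqP => [|_]; [lia|rewrite mulr0].
move=> p pn p0; apply: big1 => q _; have [q2|q2] := ltnP q 2.
  by rewrite (G_lower _ _ q2) ?mulr0 ?mul0r //; lia.
by rewrite (mu_const_weight sB) ?mulr0 //; lia.
Qed.

Lemma G_lower1 j l : (0 < j)%N -> (j < n)%N -> (l < j)%N -> G l j = 0.
Proof.
case: j => [|[|j]] // _ jn lj; last exact: G_lower.
by move: lj; rewrite ltnS leqn0 => /eqP->; exact: G01_eq0.
Qed.

Definition row_sum i j l p := \sum_(q < n) G p i * G q j * mu_const B p q l.

Lemma row_sum0 i j l : (l.+1 < n)%N -> (0 < l)%N -> row_sum i j l.+1 0 = G 0 i * G l j.
Proof.
move=> ln l0; rewrite /row_sum.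
rewrite (sum_only1 (f := fun q => G 0 i * G q j * mu_const B 0 q l.+1) (i := l)); [|lia|].
  by rewrite mu_const0 // eqxx mulr1.
move=> q qn ql; have [->|q0] := posnP q; first by rewrite mu_const_diag mulr0.
by rewrite mu_const0 //; case: eqP => [[/esym]//|_]; rewrite mulr0.
Qed.

Lemma row_sum_eq0 i j l p : (0 < p)%N -> (0 < j)%N -> (j < n)%N ->
  (l < p + j)%N || (l == p + j)%N && (l < n.-1)%N -> row_sum i j l p = 0.
Proof.
move=> p0 j0 jn H; apply: big1 => q _; have [qj|jq] := ltnP q j.
  by rewrite (G_lower1 _ _ qj) ?mulr0 ?mul0r.
by rewrite (mu_const_weight sB) ?mulr0 //; lia.
Qed.

Lemma row_sum1 i j l p : (0 < p)%N -> (0 < j)%N -> (j < n)%N ->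
  (l <= p + j)%N || (l == (p + j).+1) && (l < n.-1)%N ->
  row_sum i j l p = G p i * G j j * mu_const B p j l.
Proof.
move=> p0 j0 jn H; apply: (sum_only1 (f := fun q => G p i * G q j * mu_const B p q l)) => //.
move=> q qn qj; have [lt|ge] := ltnP q j; first by rewrite (G_lower1 _ _ lt) ?mulr0 ?mul0r.
by rewrite (mu_const_weight sB) ?mulr0 //; lia.
Qed.

Lemma row_sum2 i j l p : (0 < p)%N -> (0 < j)%N -> (l == (p + j).+2) && (l < n.-1)%N ->
  row_sum i j l p = G p i * G j j * mu_const B p j l + G p i * G j.+1 j * mu_const B p j.+1 l.
Proof.
move=> p0 j0 H.
apply: (sum_only2 (f := fun q => G p i * G q j * mu_const B p q l))
  => [|||q qn q1 q2]; [lia|lia|lia|].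
have [lt|ge] := ltnP q j; first by rewrite (G_lower1 _ _ lt) ?mulr0 ?mul0r //; lia.
by rewrite (mu_const_weight sB) ?mulr0 //; lia.
Qed.

Lemma G_diag_succ j : (0 < j)%N -> (j.+1 < n)%N ->
  G j.+1 j.+1 = (G 0 0 + G 1 0 * mu_const B 1 j j.+1) * G j j.
Proof.
move=> j0 jn; rewrite hom_ad0 //.
rewrite [LHS](sum_only2 (f := row_sum 0 j j.+1) (i := 0) (j := 1)); [|lia|lia|lia|].
  by rewrite row_sum0 // row_sum1; [ring|lia..].
by move=> p pn p0 p1; rewrite row_sum_eq0 //; lia.
Qed.

Lemma G_subdiag_succ j : (0 < j)%N -> (j.+3 < n)%N ->
  G j.+2 j.+1 = G 0 0 * G j.+1 j + G 1 0 * G j j * mu_const B 1 j j.+2.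
Proof.
move=> j0 jn; rewrite hom_ad0; [|lia..].
rewrite [LHS](sum_only2 (f := row_sum 0 j j.+2) (i := 0) (j := 1)); [|lia|lia|lia|].
  by rewrite row_sum0 ?row_sum1 //; lia.
by move=> p pn p0 p1; rewrite row_sum_eq0 //; lia.
Qed.

(** In the lowest weight that can occur, triangularity leaves only diagonal entries of [G]. One
    weight higher, in the next lemma, the subdiagonal enters. *)
Lemma hom_first_order i j l : (0 < i)%N -> (0 < j)%N -> (l < n)%N ->
  (l == i + j)%N && (l == n.-1) || (l == (i + j).+1) && (l < n.-1)%N ->
  mu_const A i j l * G l l = G i i * G j j * mu_const B i j l.
Proof.
move=> i0 j0 ln H; have [iN jN] : (i < n)%N /\ (j < n)%N by lia.
have := homG iN jN ln.
rewrite (sum_only1 (f := fun m => mu_const A i j m * G l m) ln) => [->|m mn ml].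
  rewrite [LHS](sum_only1 (f := row_sum i j l) (i := i)); [|lia|].
    by rewrite row_sum1 //; lia.
  move=> p pn pi; have [lt|ge] := ltnP p i; last by rewrite row_sum_eq0 //; lia.
  by rewrite /row_sum big1 // => q _; rewrite (G_lower1 _ _ lt) ?mul0r //; lia.
have [lt|ge] := ltnP l m; first by rewrite (G_lower1 _ _ lt) ?mulr0 //; lia.
by rewrite (mu_const_weight sA) ?mul0r //; lia.
Qed.

Lemma hom_second_order i j l : (0 < i)%N -> (0 < j)%N ->
  (l.+1 == (i + j).+2) && (l.+1 < n.-1)%N ->
  mu_const A i j l * G l.+1 l + mu_const A i j l.+1 * G l.+1 l.+1 =
  G i i * G j j * mu_const B i j l.+1 + G i i * G j.+1 j * mu_const B i j.+1 l.+1
  + G i.+1 i * G j j * mu_const B i.+1 j l.+1.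
Proof.
move=> i0 j0 H; have [iN [jN ln]] : (i < n)%N /\ (j < n)%N /\ (l.+1 < n)%N by lia.
have := homG iN jN ln.
rewrite (sum_only2 (f := fun m => mu_const A i j m * G l.+1 m) (i := l) (j := l.+1))
  => [->||||m mn ml ml']; [|lia..|].
  rewrite [LHS](sum_only2 (f := row_sum i j l.+1) (i := i) (j := i.+1)); [|lia..|].
    by rewrite row_sum2 ?row_sum1 //; lia.
  move=> p pn pi pi'; have [lt|ge] := ltnP p i; last by rewrite row_sum_eq0 //; lia.
  by rewrite /row_sum big1 // => q _; rewrite (G_lower1 _ _ lt) ?mul0r //; lia.
have [lt|ge] := ltnP l.+1 m; first by rewrite (G_lower1 _ _ lt) ?mulr0 //; lia.
by rewrite (mu_const_weight sA) ?mul0r //; lia.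
Qed.

(** Turns a consequence of a known equation into a polynomial or rational identity for [ring] or
    [field]; [cancel_eq2] also subtracts a multiple of a second equation. *)
Lemma cancel_eq (c x y u v : F) : c != 0 -> x = y -> c * (u - v) = x - y -> u = v.
Proof.
move=> c0 -> /eqP; rewrite subrr mulf_eq0 (negPf c0) /= subr_eq0 => /eqP; exact.
Qed.

Lemma cancel_eq2 (c x y m x' y' u v : F) : c != 0 -> x = y -> x' = y' ->
  c * (u - v) = x - y - m * (x' - y') -> u = v.
Proof. by move=> c0 -> -> H; apply: (cancel_eq c0 (erefl 0)); rewrite H !subrr mulr0 subr0. Qed.

Section Values.
Variable A' : nat -> nat -> F.

Lemma mu_const12 k : mu_const A' 1 2 k = A' 1 k.
Proof. by rewrite mu_const_pos // /psi_const /= psi_coef_succ. Qed.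

Lemma mu_const23 k : mu_const A' 2 3 k = A' 2 k.
Proof. by rewrite mu_const_pos // /psi_const /= psi_coef_succ. Qed.

Lemma mu_const_next i j k : (0 < i)%N -> (0 < j)%N ->
  mu_const A' i j.+1 k.+1 = mu_const A' i j k - mu_const A' i.+1 j k.+1.
Proof.
by move=> i0 j0; rewrite !mu_const_pos // (psi_const_rec A' k i0 j0) addrC addKr.
Qed.

End Values.

(** The diagonal of [G] is [al ^+ (j - 1) * be] for [1 <= j <= n - 2], whence the powers of [al].
    The bound [n >= 9] places [x_7], needed for [A 2 7], before the last basis vector. *)
Lemma iso_relation_of_hom : iso_relation n A B.
Proof.
have [al0 d20] := G00_G22_neq0.
have diag j : (0 < j)%N -> (j.+2 < n)%N -> G j.+1 j.+1 = G 0 0 * G j j.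
  by move=> j0 jn; rewrite G_diag_succ ?mu_const1_succ ?mulr0 ?addr0 //; lia.
have n' : (8 < n)%N := n_ge9.
have d2 : G 2 2 = G 0 0 * G 1 1 by rewrite diag //; lia.
have be0 : G 1 1 != 0 by move: d20; rewrite d2 mulf_eq0 negb_or => /andP[].
have d3 : G 3 3 = G 0 0 ^+ 2 * G 1 1 by rewrite diag ?d2; [ring|lia..].
have d4 : G 4 4 = G 0 0 ^+ 3 * G 1 1 by rewrite diag ?d3; [ring|lia..].
have d5 : G 5 5 = G 0 0 ^+ 4 * G 1 1 by rewrite diag ?d4; [ring|lia..].
have d6 : G 6 6 = G 0 0 ^+ 5 * G 1 1 by rewrite diag ?d5; [ring|lia..].
have d7 : G 7 7 = G 0 0 ^+ 6 * G 1 1 by rewrite diag ?d6; [ring|lia..].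
have k135 : mu_const B 1 3 5 = B 1 4.
  by rewrite mu_const_next // mu_const_diag mu_const12 subr0.
have k247 : mu_const B 2 4 7 = B 2 6.
  by rewrite mu_const_next // mu_const_diag mu_const23 subr0.
have k146 : mu_const B 1 4 6 = B 1 4 - B 2 6 by rewrite mu_const_next // k135 mu_const23.
have k157 : mu_const B 1 5 7 = B 1 4 - 2 * B 2 6 by rewrite mu_const_next // k146 k247; ring.
have e2 : G 3 2 = G 0 0 * G 2 1.
  by rewrite G_subdiag_succ ?mu_const_diag ?mulr0 ?addr0 //; lia.
have e3 : G 4 3 = G 0 0 ^+ 2 * G 2 1 + G 1 0 * G 0 0 * G 1 1 * B 1 4.
  by rewrite G_subdiag_succ ?mu_const12 ?e2 ?d2; [ring|lia..].
have e4 : G 5 4 = G 0 0 ^+ 3 * G 2 1 + 2 * G 1 0 * G 0 0 ^+ 2 * G 1 1 * B 1 4.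
  by rewrite G_subdiag_succ ?k135 ?e3 ?d3; [ring|lia..].
have e5 : G 6 5 = G 0 0 ^+ 4 * G 2 1 + G 1 0 * G 0 0 ^+ 3 * G 1 1 * (3 * B 1 4 - B 2 6).
  by rewrite G_subdiag_succ ?k146 ?e4 ?d4; [ring|lia..].
have e6 : G 7 6 = G 0 0 ^+ 5 * G 2 1 + G 1 0 * G 0 0 ^+ 4 * G 1 1 * (4 * B 1 4 - 3 * B 2 6).
  by rewrite G_subdiag_succ ?k157 ?e5 ?d5; [ring|lia..].
have f14 : G 0 0 ^+ 2 * A 1 4 = G 1 1 * B 1 4.
  have /= E := @hom_first_order 1 2 4 isT isT _ _.
  apply: (cancel_eq (mulf_neq0 al0 be0) (E _ _)); [lia|lia|].
  by rewrite !mu_const12 d4 d2; ring.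
have f26 : G 0 0 ^+ 2 * A 2 6 = G 1 1 * B 2 6.
  have /= E := @hom_first_order 2 3 6 isT isT _ _.
  apply: (cancel_eq (mulf_neq0 (expf_neq0 3 al0) be0) (E _ _)); [lia|lia|].
  by rewrite !mu_const23 d6 d3 d2; ring.
exists (G 0 0), (G 1 1), (G 1 0); split=> //.
- split.
    have /= E := @hom_second_order 1 2 4 isT isT _.
    (* The multiplier is [G 5 4 / G 0 0 ^+ 2]: it replaces [A 1 4 * G 5 4] by means of [f14], after
       which the unknown [G 2 1] cancels. *)
    apply: (cancel_eq2 (m := G 0 0 * G 2 1 + 2 * G 1 0 * G 1 1 * B 1 4) be0 (E _) f14).
      lia.
    rewrite !mu_const12 k135 [mu_const B 2 2 5]mu_const_diag d5 d2 e2 e4; ring.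
  have /= E := @hom_second_order 2 3 6 isT isT _.
  apply: (cancel_eq2 (m := G 0 0 ^+ 3 * G 2 1 + G 1 0 * G 0 0 ^+ 2 * G 1 1 *
    (4 * B 1 4 - 3 * B 2 6)) (mulf_neq0 (expf_neq0 2 al0) be0) (E _) f26); first lia.
  rewrite !mu_const23 k247 [mu_const B 3 3 7]mu_const_diag d7 d2 d3 e2 e3 e6; ring.
- have H : (1 < n)%N by lia.
  have /= E := @hom_first_order 1 n.-2 n.-1 isT _ _ _.
  have d : G n.-1 n.-1 = (G 0 0 + G 1 0 * mu_const B 1 n.-2 n.-1) * G n.-2 n.-2.
    have E1 : n.-2.+1 = n.-1 by lia.
    by have := @G_diag_succ n.-2; rewrite E1 => ->; [|lia|lia].
  have d0 : G n.-2 n.-2 != 0.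
    apply/eqP => G0; apply: G_last => l ln; have [lt|ge] := ltnP l n.-1.
      by rewrite G_lower //; lia.
    by rewrite (_ : l = n.-1) ?d ?G0 ?mulr0 //; lia.
  apply: (cancel_eq d0 (E _ _ _)); [lia|lia|lia|].
  by rewrite d; ring.
Qed.

End Invariants.

(** * Convergence of matrices and tuples, and curves in [F^n] *)

Lemma mx_cvg (T : topologicalType) (m k : nat) (S : Type) (F : set_system S) (FF : Filter F)
    (f : S -> 'M[T]_(m, k)) (M : 'M[T]_(m, k)) :
  (forall i j, f t i j @[t --> F] --> M i j) -> f t @[t --> F] --> M.
Proof.
move=> H A [P PM sPA]; suff: F (f @^-1` [set N | forall i j, P i j (N i j)]).
  by apply: filterS => t; exact: sPA.
by apply: filter_forall => i; apply: filter_forall => j; apply: H; exact: PM.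
Qed.

Lemma sum_cvg (K : numFieldType) (T : Type) (F : set_system T) (FF : Filter F)
    (I : Type) (r : seq I) (f : I -> T -> K) (l : I -> K) :
  (forall p, f p t @[t --> F] --> l p) ->
  \sum_(p <- r) f p t @[t --> F] --> \sum_(p <- r) l p.
Proof.
move=> H; elim: r => [|p r IH].
  have -> : (fun b => \sum_(p <- [::]) f p b) = cst 0 by apply/funext => b; rewrite big_nil.
  by rewrite big_nil; exact: cvg_cst.
have -> : (fun b => \sum_(q <- p :: r) f q b) = (fun b => f p b + \sum_(q <- r) f q b).
  by apply/funext => b; rewrite big_cons.
by rewrite big_cons; apply: cvgD; [exact: H|exact: IH].
Qed.

Section Topology.
Variables (R : realType) (n : nat).
Local Notation C := (Cplx R).

Lemma coords_cvg (T : Type) (F : set_system T) (FF : Filter F)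
    (f : T -> coords R n) (a : coords R n) :
  (forall p, f t p @[t --> F] --> a p) -> f t @[t --> F] --> a.
Proof.
have surj p : [set (g : coords R n) p | g in setT] = [set: C].
  by rewrite eqEsubset; split=> // y _; exists (fun=> y).
move=> H; apply/cvg_sup => p; apply/cvg_image => [|A /H FA]; first exact: surj.
exists [set g : coords R n | A (g p)] => //.
by rewrite eqEsubset; split=> [_ [g Ag <-]//|y Ay]; exists (fun=> y).
Qed.

Lemma coord_continuous p : continuous (fun a : coords R n => a p).
Proof. exact: (@proj_continuous _ (fun=> C)). Qed.

Lemma bracket_of_continuous : continuous (@bracket_of R n).
Proof.
move=> a; rewrite /continuous_at.
apply: (@mx_cvg _ _ _ _ (nbhs a) _ (@bracket_of R n) (bracket_of a)) => i j.
apply: (@mx_cvg _ _ _ _ (nbhs a) _ (fun b => bracket_of b i j)) => k z.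
rewrite (ord1 z) {z}.
have E b : bracket_of b i j k ord0 = mu0 R n i j k ord0 +
    \sum_(p : {p : 'I_n * 'I_n | p \in Delta n}) b p * psi R n (val p).1 (val p).2 i j k ord0.
  rewrite /bracket_of [X in fun_of_matrix X]mxE [LHS]mxE; congr (_ + _).
  by rewrite [X in fun_of_matrix X]mxE summxE; apply: eq_bigr => p _; rewrite mxE.
rewrite E (_ : (fun b => bracket_of b i j k ord0) = (fun b => mu0 R n i j k ord0 +
    \sum_(p : {p : 'I_n * 'I_n | p \in Delta n}) b p * psi R n (val p).1 (val p).2 i j k ord0)).
  apply: cvgD; first exact: cvg_cst.
  apply: (@sum_cvg C _ (nbhs a) _ _ _ (fun p b => b p * psi R n (val p).1 (val p).2 i j k ord0)
    (fun p => a p * psi R n (val p).1 (val p).2 i j k ord0)) => p.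
  apply: cvgM; last exact: cvg_cst.
  exact: coord_continuous.
by apply/funext => b; exact: E.
Qed.

Lemma curve_in_nbhs (a : coords R n) (V : set (coords R n)) (f : C -> coords R n)
    (P : coords R n -> Prop) : Fvar a ->
  nbhs (a : subspace (@Fvar R n)) V ->
  f t @[t --> (0 : C)] --> a -> (\forall t \near (0 : C)^', Fvar (f t) /\ P (f t)) ->
  exists b, [/\ V b, Fvar b & P b].
Proof.
move=> Fa; rewrite /nbhs /= -nbhs_subspace_in // => aV fa fP.
have /filter_ex[t [[Ft Pt] Vt]] : \forall t \near (0 : C)^', (Fvar (f t) /\ P (f t))
    /\ (Fvar (f t) -> V (f t)).
  apply: filterI => //; apply: nbhs_dnbhs; exact: fa aV.
by exists (f t); split=> //; apply: Vt.
Qed.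

End Topology.

(** * From curves of parameters to nearby non-isomorphic brackets *)

Section IsomorphismInvariants.
Variables (R : realType) (n : nat).
Hypothesis n_ge9 : (9 <= n)%N.
Local Notation C := (Cplx R).

Lemma isomorphic_relation (a b : coords R n) :
  isomorphic (bracket_of a) (bracket_of b) -> iso_relation n (coef_of a) (coef_of b).
Proof.
have n_ge4 : (4 <= n)%N by lia.
case=> g gU gab.
pose G l j := if (insub l, insub j) is (Some l', Some j') then g l' j' else 0 : C.
have GE (l j : 'I_n) : G l j = g l j by rewrite /G !valK.
apply: (@iso_relation_of_hom _ n (coef_of a) (coef_of b) G) => //.
- exact: supported_coef_of.
- exact: supported_coef_of.
- move=> i j l iN jN lN.
  have := br_act (bracket_of a) (delta_mx (Ordinal iN) ord0) (delta_mx (Ordinal jN) ord0) gU.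
  rewrite -gab br_delta => /colP/(_ (Ordinal lN)); rewrite br_entry mxE => E.
  rewrite /transformed.
  transitivity (\sum_(m < n) g (Ordinal lN) m * bracket_of a (Ordinal iN) (Ordinal jN) m ord0).
    apply: eq_bigr => m _; rewrite bracket_of_entry // mulrC.
    by rewrite -[l]/(nat_of_ord (Ordinal lN)) GE.
  rewrite -E; apply: eq_bigr => p _; apply: eq_bigr => q _.
  have col (k : 'I_n) x : (g *m delta_mx k (ord0 : 'I_1)) x ord0 = G x k.
    rewrite GE mxE (bigD1 k) //= mxE !eqxx mulr1 big1 ?addr0 // => y /negPf yk.
    by rewrite mxE yk mulr0.
  by rewrite !col bracket_of_entry.
- move=> G0; have n1 : (n.-1 < n)%N by lia.
  have : g *m delta_mx (Ordinal n1) (ord0 : 'I_1) = 0.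
    apply/colP => x; rewrite mxE (bigD1 (Ordinal n1)) //= mxE !eqxx mulr1 mxE.
    rewrite -GE G0 // big1 ?addr0 // => y /negPf yk; by rewrite mxE yk mulr0.
  move/(congr1 (mulmx (invmx g))); rewrite mulKmx // mulmx0.
  move/colP/(_ (Ordinal n1)); rewrite !mxE !eqxx => /eqP; by rewrite oner_eq0.
Qed.

Lemma deformation (a : coords R n) (V : set (coords R n)) (B : C -> nat -> nat -> C) :
  Fvar a -> nbhs (a : subspace (@Fvar R n)) V -> (forall t, supported n (B t)) ->
  (forall r s, B t r s @[t --> (0 : C)] --> coef_of a r s) ->
  (\forall t \near (0 : C)^', (forall i j k l : 'I_n, jac n (psi_const (B t)) i j k l = 0)
     /\ ~ iso_relation n (coef_of a) (B t)) ->
  exists b : coords R n,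
       [/\ V b, Fvar b, filiform (bracket_of b)
         & ~ isomorphic (bracket_of a) (bracket_of b)].
Proof.
have n_ge4 : (4 <= n)%N by lia.
move=> Fa aV sB cB H.
have coefB t : coef_of (@coords_of R n (B t)) = B t.
  by apply/funext => r; apply/funext => s; rewrite coords_ofK.
have [||b [Vb Fb niso]] := @curve_in_nbhs R n a V (fun t => @coords_of R n (B t))
  (fun b => ~ isomorphic (bracket_of a) (bracket_of b)) Fa aV.
- apply: (@coords_cvg R n C (nbhs (0 : C)) _ (fun t => @coords_of R n (B t)) a) => p.
  by rewrite -(coef_ofE a); exact: cB.
- apply: filterS H => t [Jt nt]; split; first by apply/Fvar_jac => // i j k l; rewrite coefB.
  by move/isomorphic_relation; rewrite coefB.
- by exists b; split=> //; exact: filiform_bracket_of.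
Qed.

End IsomorphismInvariants.

(** * Invariants of weights one and two, and deformations of finitely many parameters *)

Section Deformations.
Variable C : numFieldType.
Implicit Types (A B : nat -> nat -> C) (t : C).

Lemma iso_relation_weight1 m A B : iso_relation m A B ->
  exists2 k : C, k != 0 & B 1 4 = k * A 1 4 /\ B 2 6 = k * A 2 6.
Proof.
case=> al [be [ga [al0 be0 [e1 e2] _ _]]].
exists (al ^+ 2 / be); first by rewrite mulf_neq0 ?expf_neq0 ?invr_neq0.
by split; apply: (mulfI be0); rewrite -?e1 -?e2; field.
Qed.

(** The weight one relation makes [B 1 4] and [B 2 6] vanish too, which removes [ga] from the weight
    two relations. *)
Lemma iso_relation_weight2 m A B : iso_relation m A B -> A 1 4 = 0 -> A 2 6 = 0 ->
  exists2 k : C, k != 0 & B 1 5 = k * A 1 5 /\ B 2 7 = k * A 2 7.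
Proof.
move=> isoAB p0 q0; have [k _ [Bp Bq]] := iso_relation_weight1 isoAB.
case: isoAB => al [be [ga [al0 be0 _ [e1 e2] _]]].
move: e1 e2; rewrite Bp Bq p0 q0 => e1 e2.
exists (al ^+ 3 / be); first by rewrite mulf_neq0 ?expf_neq0 ?invr_neq0.
split; apply: (mulfI (mulf_neq0 be0 al0)).
  by transitivity (al ^+ 4 * A 1 5); [rewrite e1; ring|field].
by transitivity (al ^+ 4 * A 2 7); [rewrite e2; ring|field].
Qed.

(** Weight zero constants vanish before the top degree, so the derivation rule makes those in the
    top degree alternate in sign, from [[x_4, x_5]] down to [[x_1, x_8]]. *)
Lemma mu_const189 A : supported 10 A -> mu_const A 1 8 9 = - A 4 9.
Proof.
move=> sA; rewrite mu_const_next // (mu_const_weight sA) // mu_const_next //.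
rewrite (mu_const_weight sA) // mu_const_next // (mu_const_weight sA) //.
by rewrite mu_const_pos // /psi_const /= psi_coef_succ; ring.
Qed.

(* Where [A 4 9 != 0], the centralizer of the last but one term of the descending central
   series singles out the line spanned by [A 4 9 *: x_0 + x_1] modulo the derived algebra.
   These are the two weight two parameters of the quotient by the centre, with respect to
   an adapted basis whose first vector lies on that line. *)
Definition shifted15 A := A 1 5 - 2 * A 1 4 ^+ 2 / A 4 9.
Definition shifted27 A := A 2 7 + 3 * (A 2 6 ^+ 2 - A 1 4 * A 2 6) / A 4 9.

(** The last clause of [iso_relation] is linear in [ga] and gives [ga = al / B 4 9 - be / A 4 9].
    Its two summands become the corrections in the shifted parameters of [B] and of [A]. *)
Lemma iso_relation_shifted A B : supported 10 A -> supported 10 B ->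
  iso_relation 10 A B -> A 4 9 != 0 -> B 4 9 != 0 ->
  exists2 k : C, k != 0 &
    shifted15 B = k * shifted15 A /\ shifted27 B = k * shifted27 A.
Proof.
move=> sA sB isoAB cA cB.
case: isoAB => al [be [ga [al0 be0 [e1 e2] [e3 e4]]]].
rewrite /= !mu_const189 // => e5.
have gaE : ga = al / B 4 9 - be / A 4 9.
  apply: (mulfI (mulf_neq0 cA cB)).
  have -> : A 4 9 * B 4 9 * (al / B 4 9 - be / A 4 9) = A 4 9 * al - be * B 4 9.
    by field; rewrite cA cB.
  apply/eqP; rewrite -subr_eq0; apply/eqP.
  have := e5; move/eqP; rewrite -subr_eq0 => /eqP e.
  by rewrite -[RHS]e; ring.
have pA : A 1 4 = be * B 1 4 / al ^+ 2 by rewrite -e1; field.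
have qA : A 2 6 = be * B 2 6 / al ^+ 2 by rewrite -e2; field.
exists (al ^+ 3 / be); first by rewrite mulf_neq0 ?expf_neq0 ?invr_neq0.
have p2A : A 1 5 = be * (al * B 1 5 - 2 * ga * B 1 4 ^+ 2) / al ^+ 4 by rewrite -e3; field.
have q2A : A 2 7 = be * (al * B 2 7 + 3 * ga * (B 2 6 ^+ 2 - B 1 4 * B 2 6)) / al ^+ 4.
  by rewrite -e4; field.
rewrite /shifted15 /shifted27 p2A q2A pA qA gaE; split; field; by rewrite ?al0 ?be0 ?cA ?cB.
Qed.

(** A determinant would not do, as [(x, y)] may be zero: then it is [k != 0] or not, any nonzero
    point fails to be a multiple of it. *)
Lemma nonproportional_direction (x y : C) : exists u v : C, forall t, t != 0 ->
  ~ (exists2 k : C, k != 0 & x + t * u = k * x /\ y + t * v = k * y).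
Proof.
have [->|x0] := eqVneq x 0.
  exists 1, 0 => t t0 [k _ [/eqP]]; by rewrite mulr1 mulr0 add0r (negPf t0).
exists 0, 1 => t t0 [k _ []]; rewrite mulr0 addr0 mulr1 -{1}[x]mul1r => /(mulIf x0) <-.
by rewrite mul1r => /eqP; rewrite -subr_eq0 addrAC subrr add0r (negPf t0).
Qed.

Lemma nonproportional (x y u v : C) : x * v - y * u != 0 ->
  ~ (exists2 k : C, k != 0 & u = k * x /\ v = k * y).
Proof. by move=> /eqP H [k _ [uE vE]]; apply: H; rewrite uE vE; ring. Qed.

(** Listing only the parameters that change keeps the support and convergence conditions finite and
    computable. *)
Definition deform A (U : seq (nat * nat * (C -> C))) t r s :=
  foldr (fun x y => if (x.1.1 == r) && (x.1.2 == s) then x.2 t else y) (A r s) U.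

Lemma deform_supported n A U t : supported n A ->
  all (fun x => in_Delta n x.1.1 x.1.2) U -> supported n (deform A U t).
Proof.
move=> sA UD r s rs; elim: U UD => [_|x U IH /andP[xD UD]] /=; first exact: sA.
case: andP => [[/eqP xr /eqP xs]|_]; last exact: IH.
by move: rs; rewrite -xr -xs xD.
Qed.

Lemma deform_cvg A U (F : set_system C) Q : Filter F ->
  foldr (fun x P => (x.2 t @[t --> F] --> A x.1.1 x.1.2) /\ P) Q U ->
  forall r s, deform A U t r s @[t --> F] --> A r s.
Proof.
move=> FF HU r s; elim: U HU => [_|x U IH [Hx HU]]; first exact: cvg_cst.
rewrite /deform /=; case: andP => [[/eqP <- /eqP <-]//|_]; exact: IH.
Qed.

(* [e] collects the denominators occurring in the deformation. The filter is abstract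
   because the filter instance of [nbhs (0 : C)] is not inferred for a [numFieldType]. *)
Definition deformable n A := exists (U : seq (nat * nat * (C -> C))) (e : C -> C) (e0 : C),
  [/\ all (fun x => in_Delta n x.1.1 x.1.2) U,
      forall F : set_system C, Filter F -> t @[t --> F] --> (0 : C) ->
        foldr (fun x P => (x.2 t @[t --> F] --> A x.1.1 x.1.2) /\ P)
          (e t @[t --> F] --> e0) U,
      e0 != 0 &
      forall t, t != 0 -> e t != 0 ->
      (forall i j k l : 'I_n, jac n (psi_const (deform A U t)) i j k l = 0)
      /\ ~ iso_relation n A (deform A U t)].

End Deformations.

Lemma deformable_coords (R : realType) n (a : coords R n) (V : set (coords R n)) :
  (9 <= n)%N -> Fvar a -> nbhs (a : subspace (@Fvar R n)) V ->
  deformable n (coef_of a) ->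
  exists b : coords R n,
       [/\ V b, Fvar b, filiform (bracket_of b)
         & ~ isomorphic (bracket_of a) (bracket_of b)].
Proof.
move=> n9 Fa aV [U [e [e0 [UD cU e00 H]]]].
have {}cU := cU _ (nbhs_filter (0 : Cplx R)) (@cvg_id _ _).
apply: (@deformation R n n9 a V (deform (coef_of a) U)) => //.
- by move=> t; apply: deform_supported => //; apply: supported_coef_of; lia.
- exact: (@deform_cvg _ _ _ _ _ (nbhs_filter (0 : Cplx R)) cU).
- have ce : e t @[t --> (0 : Cplx R)] --> e0 by elim: {UD H} U cU => // x U IH [_ /IH].
  have en : \forall t \near (0 : Cplx R)^', e t != 0.
    apply: nbhs_dnbhs; exact: (@cvgr_neq0 _ _ _ _ (nbhs_filter (0 : Cplx R)) _ _ ce).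
  near=> t; apply: H; last by near: t.
  by near: t; exact: nbhs_dnbhs_neq.
Unshelve. all: by end_near. Qed.

(** * The rational curves through each solution for [n = 9, 10, 11] *)

Section DeformableCases.
Variable C : numFieldType.
Implicit Types (A : nat -> nat -> C) (t : C).

Lemma cvg_eq (T : Type) (F : set_system T) (f : T -> C) (l m : C) :
  f t @[t --> F] --> l -> l = m -> f t @[t --> F] --> m.
Proof. by move=> H <-. Qed.

(** Leaves the equation between the value at [t = 0] and the parameter of [A]; this is where the
    equations satisfied by [A] enter. Only sums and products are treated, hence squares in the
    curves are written as products. *)
Ltac cvg_rational :=
  apply: cvg_eq; [repeat first [exact: cvg_cst | eassumption | apply: cvgD | apply: cvgN
    | apply: cvgM]|].

Ltac deform_simpl := rewrite /quad8 /quad9 /quad10 /deform /=.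

Let two_neq0 : 2 != 0 :> C. Proof. by rewrite pnatr_eq0. Qed.
Let three_neq0 : 3 != 0 :> C. Proof. by rewrite pnatr_eq0. Qed.

Lemma quad8_solve A : quad8 A = 0 -> 2 * A 1 4 + A 2 6 != 0 ->
  A 3 8 = 3 * (A 2 6 * A 2 6) / (2 * A 1 4 + A 2 6).
Proof.
by move=> /eqP; rewrite subr_eq0 => /eqP E D0; apply: (canRL (mulfK D0)); rewrite -E expr2.
Qed.

Lemma quad8_degenerate A : quad8 A = 0 -> 2 * A 1 4 + A 2 6 = 0 -> A 1 4 = 0 /\ A 2 6 = 0.
Proof.
move=> E D0; have q0 : A 2 6 = 0.
  move: E => /eqP; rewrite /quad8 D0 mulr0 subr0 mulf_eq0 (negPf three_neq0) /=.
  by rewrite expf_eq0 => /eqP.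
move: D0; rewrite q0 addr0 => /eqP; rewrite mulf_eq0 (negPf two_neq0) /= => /eqP.
by [].
Qed.

(* Along these deformations [2 * A 1 4 + A 2 6] stays constant. *)
Lemma line_not_iso n A U t : 2 * A 1 4 + A 2 6 != 0 -> t != 0 ->
  deform A U t 1 4 = A 1 4 + t -> deform A U t 2 6 = A 2 6 - 2 * t ->
  ~ iso_relation n A (deform A U t).
Proof.
move=> D0 t0 p q /iso_relation_weight1; rewrite p q; apply: nonproportional.
have -> : A 1 4 * (A 2 6 - 2 * t) - A 2 6 * (A 1 4 + t) = - (t * (2 * A 1 4 + A 2 6)) by ring.
by rewrite oppr_eq0 mulf_neq0.
Qed.

Lemma weight1_not_iso n A U t : A 1 4 = 0 -> A 2 6 = 0 ->
  deform A U t 1 4 != 0 \/ deform A U t 2 6 != 0 -> ~ iso_relation n A (deform A U t).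
Proof.
move=> p0 q0 H /iso_relation_weight1[k _]; rewrite p0 q0 mulr0 => -[p q].
by move: H; rewrite p q eqxx; case.
Qed.

Lemma weight2_not_iso n A U t : A 1 4 = 0 -> A 2 6 = 0 -> A 1 5 = 0 -> A 2 7 = 0 ->
  deform A U t 1 5 != 0 \/ deform A U t 2 7 != 0 -> ~ iso_relation n A (deform A U t).
Proof.
move=> p0 q0 p20 q20 H /iso_relation_weight2 /(_ p0 q0)[k _]; rewrite p20 q20 mulr0 => -[p q].
by move: H; rewrite p q eqxx; case.
Qed.

Lemma deformable9 A : supported 9 A -> quad8 A = 0 -> deformable 9 A.
Proof.
move=> sA E8.
have [D0|D0] := eqVneq (2 * A 1 4 + A 2 6) 0; last first.
  exists [:: ((1, 4)%N, fun t => A 1 4 + t); ((2, 6)%N, fun t => A 2 6 - 2 * t);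
    ((3, 8)%N, fun t => 3 * ((A 2 6 - 2 * t) * (A 2 6 - 2 * t)) / (2 * A 1 4 + A 2 6))].
  exists (fun=> 1), 1; split; [by []| |exact: oner_neq0|].
    move=> F FF F0 /=; split; first by cvg_rational; ring.
    split; first by cvg_rational; ring.
    split; last exact: cvg_cst.
    by cvg_rational; rewrite (quad8_solve E8 D0) mulr0 subr0.
  move=> t t0 _; split; last exact: line_not_iso.
  apply/jac_psi9; first exact: deform_supported.
  by deform_simpl; field.
have [p0 q0] := quad8_degenerate E8 D0.
have [r0|r0] := eqVneq (A 3 8) 0.
  exists [:: ((1, 4)%N, fun t => t)].
  exists (fun=> 1), 1; split; [by []| |exact: oner_neq0|].
    by move=> F FF F0 /=; rewrite p0; split=> //; exact: cvg_cst.
  move=> t t0 _; split; last by apply: weight1_not_iso => //; left.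
  apply/jac_psi9; first exact: deform_supported.
  by deform_simpl; rewrite q0 r0; ring.
(* Now [A 3 8] is the denominator: [quad8] is solved for [A 1 4] with [A 2 6 = t]. *)
exists [:: ((1, 4)%N, fun t => 3 * (t * t) / (2 * A 3 8) - t / 2); ((2, 6)%N, fun t => t)].
exists (fun=> 1), 1; split; [by []| |exact: oner_neq0|].
  move=> F FF F0 /=; rewrite p0 q0; split; first by cvg_rational; ring.
  by split=> //; exact: cvg_cst.
move=> t t0 _; split; last by apply: weight1_not_iso => //; right.
apply/jac_psi9; first exact: deform_supported.
by deform_simpl; field.
Qed.

(** If [A 4 9 != 0], the last equation gives [A 3 8 = 2 * A 1 4 - A 2 6], and [quad8] becomes
    [4 * (A 2 6 ^+ 2 - A 1 4 ^+ 2)]. The weight one point can then not move, and the shifted weight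
    two point is moved instead, with [quad9] solved for [A 1 6]. If [A 4 9 = 0], the last equation
    is empty. *)
Lemma deformable10 A : supported 10 A -> quad8 A = 0 -> quad9 A = 0 ->
  A 4 9 * (2 * A 1 4 - A 2 6 - A 3 8) = 0 -> deformable 10 A.
Proof.
move=> sA E8 E9 Ec.
have [c0|c0] := eqVneq (A 4 9) 0; last first.
  have [u [v uv]] := nonproportional_direction (shifted15 A) (shifted27 A).
  exists [:: ((1, 5)%N, fun t => A 1 5 + t * u); ((2, 7)%N, fun t => A 2 7 + t * v);
    ((1, 6)%N, fun t => ((A 3 9 * (2 * A 1 4 + A 2 6)
       + 3 * A 3 8 * (A 1 5 + t * u + (A 2 7 + t * v))
       - 7 * A 2 6 * (A 2 7 + t * v)) / A 4 9 - A 2 8) / 2)].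
  exists (fun=> 1), 1; split; [by []| |exact: oner_neq0|].
    move=> F FF F0 /=; split; first by cvg_rational; ring.
    split; first by cvg_rational; ring.
    split; last exact: cvg_cst.
    cvg_rational.
    apply: (cancel_eq (mulf_neq0 two_neq0 c0) (esym E9)).
    by rewrite /quad9; field.
  move=> t t0 _; split.
    apply/jac_psi10; first exact: deform_supported.
    by split; deform_simpl; [exact: E8|field|exact: Ec].
  move=> isoA; move: (isoA) => /(iso_relation_shifted sA).
  case=> [||//|k k0 [H1 H2]]; [exact: deform_supported|exact: c0|].
  apply: (uv t t0); exists k => //.
  rewrite -H1 -H2 /shifted15 /shifted27; deform_simpl; split; ring.
have [D0|D0] := eqVneq (2 * A 1 4 + A 2 6) 0; last first.
  pose r t := 3 * ((A 2 6 - 2 * t) * (A 2 6 - 2 * t)) / (2 * A 1 4 + A 2 6).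
  exists [:: ((1, 4)%N, fun t => A 1 4 + t); ((2, 6)%N, fun t => A 2 6 - 2 * t);
    ((3, 8)%N, r); ((3, 9)%N, fun t => (7 * (A 2 6 - 2 * t) * A 2 7
       - 3 * r t * (A 1 5 + A 2 7)) / (2 * A 1 4 + A 2 6))].
  exists (fun=> 1), 1; split; [by []| |exact: oner_neq0|].
    move=> F FF F0 /=.
    have rF : r t @[t --> F] --> A 3 8.
      by rewrite /r; cvg_rational; rewrite (quad8_solve E8 D0) mulr0 subr0.
    split; first by cvg_rational; ring.
    split; first by cvg_rational; ring.
    split; first exact: rF.
    split; last exact: cvg_cst.
    cvg_rational; apply: (cancel_eq D0 E9).
    by rewrite /quad9 c0; field.
  move=> t t0 _; split; last exact: line_not_iso.
  apply/jac_psi10; first exact: deform_supported.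
  by split; deform_simpl; rewrite ?c0 /r; field.
have [p0 q0] := quad8_degenerate E8 D0.
have [r0|r0] := eqVneq (A 3 8) 0.
  have [u [v uv]] := nonproportional_direction (A 1 5) (A 2 7).
  exists [:: ((1, 5)%N, fun t => A 1 5 + t * u); ((2, 7)%N, fun t => A 2 7 + t * v)].
  exists (fun=> 1), 1; split; [by []| |exact: oner_neq0|].
    move=> F FF F0 /=; split; first by cvg_rational; ring.
    split; first by cvg_rational; ring.
    exact: cvg_cst.
  move=> t t0 _; split.
    apply/jac_psi10; first exact: deform_supported.
    by split; deform_simpl; rewrite p0 q0 r0 ?c0; ring.
  by move/iso_relation_weight2 => /(_ p0 q0) /(uv t t0).
(* [quad8] is solved for [A 1 4] and [quad9] for [A 1 5]; on this curve [2 * A 1 4 + A 2 6] is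
   [3 * (t * t) / A 3 8]. *)
exists [:: ((1, 4)%N, fun t => 3 * (t * t) / (2 * A 3 8) - t / 2); ((2, 6)%N, fun t => t);
  ((1, 5)%N, fun t => (7 * t * A 2 7 - A 3 9 * (3 * (t * t) / A 3 8)) / (3 * A 3 8) - A 2 7)].
exists (fun=> 1), 1; split; [by []| |exact: oner_neq0|].
  move=> F FF F0 /=; rewrite p0 q0; split; first by cvg_rational; ring.
  split=> //; split; last exact: cvg_cst.
  cvg_rational; apply: (cancel_eq (mulf_neq0 three_neq0 r0) E9).
  by rewrite /quad9 p0 q0 c0; field.
move=> t t0 _; split; last by apply: weight1_not_iso => //; right.
apply/jac_psi10; first exact: deform_supported.
by split; deform_simpl; rewrite ?c0; field.
Qed.

(** If the factor vanished, the second equation would read [A 3 8 * (2 * A 2 6 - 3 * A 3 8) = 0].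
    With [quad8], the first alternative gives [A 2 6 = 0], and the second gives
    [quad8 A = 11 / 4 * A 3 8 ^+ 2]; both end in [A 1 4 = A 2 6 = 0]. *)
Lemma denominator_neq0 A : quad8 A = 0 ->
  A 4 10 * (2 * A 1 4 - A 2 6 - A 3 8) = 4 * A 2 6 * A 3 8 - 6 * A 3 8 ^+ 2 ->
  2 * A 1 4 + A 2 6 != 0 -> 2 * A 1 4 - A 2 6 - A 3 8 != 0.
Proof.
move=> E8 Et D0; apply/eqP => M0.
have pE : A 1 4 = (A 2 6 + A 3 8) / 2.
  by apply: (cancel_eq two_neq0 M0); field.
have q0 : A 2 6 = 0.
  move: Et => /eqP; rewrite M0 mulr0 eq_sym.
  have -> : 4 * A 2 6 * A 3 8 - 6 * A 3 8 ^+ 2 = 2 * A 3 8 * (2 * A 2 6 - 3 * A 3 8) by ring.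
  rewrite !mulf_eq0 (negPf two_neq0) /= => /orP[/eqP r0|/eqP H].
    move: E8 => /eqP; rewrite /quad8 r0 mul0r subr0 mulf_eq0 (negPf three_neq0) /=.
    by rewrite expf_eq0 => /eqP.
  have qE : A 2 6 = 3 * A 3 8 / 2 by apply: (cancel_eq two_neq0 H); field.
  have : 11 * (A 3 8 ^+ 2) = 0.
    by apply: (cancel_eq (_ : 4^-1 != 0) E8); rewrite ?invr_eq0 ?pnatr_eq0 // /quad8 pE qE; field.
  move=> /eqP; rewrite mulf_eq0 pnatr_eq0 expf_eq0 /= => /eqP r0.
  by rewrite qE r0; ring.
have r0 : A 3 8 = 0.
  move: E8 => /eqP; rewrite /quad8 q0 pE q0 expr0n mulr0 sub0r oppr_eq0.
  rewrite (_ : 2 * _ + 0 = A 3 8) ?mulf_eq0 ?orbb => [/eqP //|]; by field.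
by case/eqP: D0; rewrite pE q0 r0; ring.
Qed.

(** The last equation is solved for [A 4 10], whose coefficient varies along the curve; this is why
    a denominator [e] is needed. When [A 1 4], [A 2 6] and [A 3 8] vanish, only [quad10] restricts
    the weight two point, which is moved instead. *)
Lemma deformable11 A : supported 11 A -> quad8 A = 0 -> quad9 A = 0 -> quad10 A = 0 ->
  A 4 10 * (2 * A 1 4 - A 2 6 - A 3 8) = 4 * A 2 6 * A 3 8 - 6 * A 3 8 ^+ 2 ->
  deformable 11 A.
Proof.
move=> sA E8 E9 E10 Et; have c0 : A 4 9 = 0 by apply: sA.
have [D0|D0] := eqVneq (2 * A 1 4 + A 2 6) 0; last first.
  have M0 := denominator_neq0 E8 Et D0.
  have tE := canRL (mulfK M0) Et.
  pose q t := A 2 6 - 2 * t.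
  pose r t := 3 * (q t * q t) / (2 * A 1 4 + A 2 6).
  pose M t := 2 * (A 1 4 + t) - q t - r t.
  pose s t := (4 * q t * r t - 6 * (r t * r t)) * (M t)^-1.
  pose r2 t := (7 * q t * A 2 7 - 3 * r t * (A 1 5 + A 2 7)) / (2 * A 1 4 + A 2 6).
  exists [:: ((1, 4)%N, fun t => A 1 4 + t); ((2, 6)%N, q); ((3, 8)%N, r); ((4, 10)%N, s);
    ((3, 9)%N, r2); ((3, 10)%N, fun t => (8 * q t * A 2 8 - 2 * r t * (2 * A 1 6 + 3 * A 2 8)
     + s t * (2 * A 1 6 + A 2 8) + 4 * (A 2 7 * A 2 7) - 3 * r2 t * (A 1 5 + A 2 7))
       / (2 * A 1 4 + A 2 6))].
  exists M, (2 * A 1 4 - A 2 6 - A 3 8); split; [by []| |exact: M0|].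
    move=> F FF F0 /=.
    have qF : q t @[t --> F] --> A 2 6 by rewrite /q; cvg_rational; ring.
    have rF : r t @[t --> F] --> A 3 8.
      by rewrite /r; cvg_rational; rewrite (quad8_solve E8 D0).
    have MF : M t @[t --> F] --> 2 * A 1 4 - A 2 6 - A 3 8.
      by rewrite /M; cvg_rational; ring.
    have MVF : (M t)^-1 @[t --> F] --> (2 * A 1 4 - A 2 6 - A 3 8)^-1 by exact: (cvgV M0 MF).
    have sF : s t @[t --> F] --> A 4 10.
      by rewrite /s; cvg_rational; rewrite tE; ring.
    have r2F : r2 t @[t --> F] --> A 3 9.
      rewrite /r2; cvg_rational; apply: (cancel_eq D0 E9).
      by rewrite /quad9 c0; field.
    split; first by cvg_rational; ring.
    split; first exact: qF.
    split; first exact: rF.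
    split; first exact: sF.
    split; first exact: r2F.
    split; last exact: MF.
    cvg_rational; apply: (cancel_eq D0 E10).
    by rewrite /quad10; field.
  move=> t t0 Mt0; split; last exact: line_not_iso.
  apply/jac_psi11; first exact: deform_supported.
  split; deform_simpl; rewrite ?c0.
  - by rewrite /r /q; field.
  - by rewrite /r2 /r /q; field.
  - by rewrite /r2 /r /q; field.
  - by rewrite /s -/(M t) mulfVK // expr2.
have [p0 q0] := quad8_degenerate E8 D0.
have [r0|r0] := eqVneq (A 3 8) 0; last first.
  have tE : A 4 10 = 6 * A 3 8.
    by apply: (cancel_eq r0 (esym Et)); rewrite p0 q0; ring.
  have p2E : A 1 5 = - A 2 7.
    by apply: (cancel_eq (mulf_neq0 three_neq0 r0) (esym E9)); rewrite /quad9 p0 q0 c0; ring.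
  pose r := A 3 8.
  pose p t := 3 * (t * t) / (2 * r) - t / 2.
  pose M t := 2 * p t - t - r.
  pose s t := (4 * t * r - 6 * (r * r)) * (M t)^-1.
  pose p2 t := (7 * t * A 2 7 - A 3 9 * (3 * (t * t) / r)) / (3 * r) - A 2 7.
  (* [N] is the coefficient of [A 1 6] in [quad10]. As [A 4 10 = 6 * r] at [t = 0], it starts at
     [8 * r]. *)
  pose N t := 2 * s t - 4 * r.
  exists [:: ((1, 4)%N, p); ((2, 6)%N, id); ((4, 10)%N, s); ((1, 5)%N, p2);
   ((1, 6)%N, fun t => - (8 * t * A 2 8 - A 3 10 * (3 * (t * t) / r) - 6 * r * A 2 8
     + s t * A 2 8 + 4 * (A 2 7 * A 2 7) - 3 * A 3 9 * (p2 t + A 2 7)) * (N t)^-1)].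
  exists (fun t => M t * N t), (- r * (8 * r)); split; [by []| | |].
  - move=> F FF F0 /=.
    have pF : p t @[t --> F] --> A 1 4 by rewrite /p; cvg_rational; rewrite p0; ring.
    have MF : M t @[t --> F] --> - r by rewrite /M; cvg_rational; rewrite p0; ring.
    have rN0 : - r != 0 by rewrite oppr_eq0.
    have MVF : (M t)^-1 @[t --> F] --> (- r)^-1 by exact: (cvgV rN0 MF).
    have sF : s t @[t --> F] --> A 4 10.
      by rewrite /s; cvg_rational; rewrite tE /r; field.
    have p2F : p2 t @[t --> F] --> A 1 5.
      by rewrite /p2; cvg_rational; rewrite p2E; ring.
    have NF : N t @[t --> F] --> 8 * r by rewrite /N; cvg_rational; rewrite tE /r; ring.
    have N0 : 8 * r != 0 by rewrite mulf_neq0 // pnatr_eq0.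
    have NVF : (N t)^-1 @[t --> F] --> (8 * r)^-1 by exact: (cvgV N0 NF).
    split; first exact: pF.
    split; first by rewrite q0; exact: F0.
    split; first exact: sF.
    split; first exact: p2F.
    split; last by apply: cvgM; [exact: MF|exact: NF].
    cvg_rational; apply: (cancel_eq N0 (esym E10)).
    by rewrite /quad10 p0 q0 tE p2E /r; field.
  - by rewrite mulf_neq0 ?oppr_eq0 // mulf_neq0 // pnatr_eq0.
  - move=> t t0; rewrite mulf_eq0 negb_or => /andP[Mt0 Nt0].
    split; last by apply: weight1_not_iso => //; right.
    apply/jac_psi11; first exact: deform_supported.
    split; deform_simpl; rewrite ?c0.
    + by rewrite /p /r; field.
    + by rewrite mul0r addr0 /p2 /p /r; field.
    + set x := (- _ / N t); have xN : x * N t = - _ := divfK Nt0 _.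
      apply: (cancel_eq (oner_neq0 C) xN).
      by move: x {xN} => x; rewrite /N /p /r; field.
    + by rewrite /s -/r -/(M t) mulfVK // expr2.
have [s0|s0] := eqVneq (A 4 10) 0; last first.
  have [u [v uv]] := nonproportional_direction (A 1 5) (A 2 7).
  exists [:: ((1, 5)%N, fun t => A 1 5 + t * u); ((2, 7)%N, fun t => A 2 7 + t * v);
    ((1, 6)%N, fun t => ((3 * A 3 9 * (A 1 5 + t * u + (A 2 7 + t * v))
        - 4 * ((A 2 7 + t * v) * (A 2 7 + t * v))) / A 4 10 - A 2 8) / 2)].
  exists (fun=> 1), 1; split; [by []| |exact: oner_neq0|].
    move=> F FF F0 /=; split; first by cvg_rational; ring.
    split; first by cvg_rational; ring.
    split; last exact: cvg_cst.
    cvg_rational; apply: (cancel_eq (mulf_neq0 two_neq0 s0) (esym E10)).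
    by rewrite /quad10 p0 q0 r0; field.
  move=> t t0 _; split.
    apply/jac_psi11; first exact: deform_supported.
    split; deform_simpl; rewrite p0 q0 r0 ?c0; [ring|ring|field|ring]; done.
  by move/iso_relation_weight2 => /(_ p0 q0) /(uv t t0).
have EQ : 4 * A 2 7 ^+ 2 = 3 * A 3 9 * (A 1 5 + A 2 7).
  by apply: (cancel_eq (oner_neq0 _) E10); rewrite /quad10 p0 q0 r0 s0; ring.
(* [EQ] has the shape of [quad8], with [A 2 7], [A 3 9], [A 1 5 + A 2 7] for [A 2 6], [A 3 8],
   [2 * A 1 4 + A 2 6], so the same three cases arise. The direction [(1, -1)] keeps [A 1 5 + A 2 7]
   constant. *)
have [S0|S0] := eqVneq (A 1 5 + A 2 7) 0; last first.
  exists [:: ((1, 5)%N, fun t => A 1 5 + t); ((2, 7)%N, fun t => A 2 7 - t);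
    ((3, 9)%N, fun t => 4 * ((A 2 7 - t) * (A 2 7 - t)) / (3 * (A 1 5 + A 2 7)))].
  exists (fun=> 1), 1; split; [by []| |exact: oner_neq0|].
    move=> F FF F0 /=; split; first by cvg_rational; ring.
    split; first by cvg_rational; ring.
    split; last exact: cvg_cst.
    cvg_rational; apply: (cancel_eq (mulf_neq0 three_neq0 S0) EQ); field.
    by rewrite S0.
  move=> t t0 _; split.
    apply/jac_psi11; first exact: deform_supported.
    split; deform_simpl; rewrite p0 q0 r0 ?c0 ?s0; [ring|ring|field|ring]; by rewrite S0.
  move/iso_relation_weight2 => /(_ p0 q0); apply: nonproportional; deform_simpl.
  have -> : A 1 5 * (A 2 7 - t) - A 2 7 * (A 1 5 + t) = - (t * (A 1 5 + A 2 7)) by ring.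
  by rewrite oppr_eq0 mulf_neq0.
have q20 : A 2 7 = 0.
  by move: EQ => /eqP; rewrite S0 mulr0 mulf_eq0 pnatr_eq0 expf_eq0 => /eqP.
have p20 : A 1 5 = 0 by move: S0; rewrite q20 addr0.
have [r20|r20] := eqVneq (A 3 9) 0.
  exists [:: ((1, 5)%N, fun t => t)].
  exists (fun=> 1), 1; split; [by []| |exact: oner_neq0|].
    by move=> F FF F0 /=; rewrite p20; split=> //; exact: cvg_cst.
  move=> t t0 _; split; last by apply: weight2_not_iso => //; left.
  apply/jac_psi11; first exact: deform_supported.
  by split; deform_simpl; rewrite p0 q0 r0 ?c0 ?s0 ?r20 ?q20; ring.
exists [:: ((1, 5)%N, fun t => 4 * (t * t) / (3 * A 3 9) - t); ((2, 7)%N, fun t => t)].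
exists (fun=> 1), 1; split; [by []| |exact: oner_neq0|].
  move=> F FF F0 /=; rewrite p20 q20; split; first by cvg_rational; ring.
  by split=> //; exact: cvg_cst.
move=> t t0 _; split; last by apply: weight2_not_iso => //; right.
apply/jac_psi11; first exact: deform_supported.
by split; deform_simpl; rewrite p0 q0 r0 ?c0 ?s0; [ring|ring|field|ring].
Qed.

End DeformableCases.

(** * Vergne's theorem: the lower central series and an adapted basis *)

Section DescendingSeries.
Variables (R : realType) (n : nat) (mu : bilmap R n).
Local Notation C := (Cplx R).
Local Notation V := 'cV[C]_n.
Local Notation L := (lcs mu).
Hypotheses (n_ge4 : (4 <= n)%N) (lie_mu : lie_variety mu)
  (nil_mu : nilpotent_of_class mu n.-1).

Lemma lcsS_sub k : (L k.+1 <= L k)%VS.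
Proof.
elim: k => [|k IH]; first exact: subvf.
by apply: lcs_sub => x y yk; apply: lcs_br; apply: (subvP IH).
Qed.

Lemma lcs_subset i j : (i <= j)%N -> (L j <= L i)%VS.
Proof.
move/subnK <-; elim: (j - i)%N => [|k IH] //.
by apply: subv_trans IH; rewrite addSn; exact: lcsS_sub.
Qed.

Lemma br_br_l x y z : br mu (br mu x y) z = br mu x (br mu y z) - br mu y (br mu x z).
Proof.
case: lie_mu => alt jac; have := jac x y z.
rewrite (br_anti (br mu y z) x alt) (br_anti (br mu z x) y alt) (br_anti z x alt) brNr opprK.
move=> /eqP.
by rewrite -addrA addr_eq0 opprD opprK => /eqP.
Qed.

Lemma lcs_br_lcs i j x y : x \in L i -> y \in L j -> br mu x y \in L (i + j).+1.
Proof.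
elim: i j x y => [|i IH] j x y xi yj; first exact: lcs_br.
elim/lcs_ind: xi => [|c u v Hu Hv|u v vi].
- by rewrite br0l mem0v.
- by rewrite brDl brZl memvD // memvZ.
- rewrite br_br_l memvB //; first by apply: lcs_br; exact: IH.
  by rewrite addSnnS; apply: IH => //; exact: lcs_br.
Qed.

Lemma lcs_dim_lt k : (k < n.-1)%N -> (\dim (L k.+1) < \dim (L k))%N.
Proof.
case: nil_mu => L0 Lk kn; have := dimvS (lcsS_sub k); rewrite leq_eqVlt => /orP[/eqP dE|//].
have E : L k.+1 = L k by apply/eqP; rewrite eqEdim lcsS_sub dE leqnn.
have Em m : L (k + m) = L k.
  elim: m => [|m IH]; first by rewrite addn0.
  by rewrite addnS -[RHS]E /= IH.
by case: (Lk k kn); rewrite -(Em (n.-1 - k)%N) subnKC ?L0 // ltnW.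
Qed.

Lemma vspace_hyperplane (U W : {vspace V}) e : (U <= W)%VS -> e \in W -> e \notin U ->
  (\dim W <= (\dim U).+1)%N -> forall v, v \in W -> exists c, v - c *: e \in U.
Proof.
move=> UW eW eU dW v vW.
have WE : (<[e]> + U)%VS = W.
  apply/eqP; rewrite eqEdim subv_add UW -memvE eW /=; apply: leq_trans dW _.
  rewrite ltn_neqAle dimvS ?addvSr // andbT; apply: contra eU => /eqP dE.
  have /eqP -> : U == (<[e]> + U)%VS by rewrite eqEdim addvSr dE leqnn.
  by rewrite memvE addvSl.
move: vW; rewrite -WE => /memv_addP[_ /vlineP[c ->] [u uU ->]].
by exists c; rewrite addrAC subrr add0r.
Qed.

Lemma dim_full : \dim (fullv : {vspace V}) = n.
Proof. by rewrite dimvf /dim /= muln1. Qed.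

(** If one vector [e] spanned the algebra modulo [L 1], then [[e, e] = 0] would put every bracket
    into [L 2], against the strict decrease. *)
Lemma lcs1_dim : (\dim (L 1) <= n - 2)%N.
Proof.
have d0 := lcs_dim_lt (ltac:(lia) : 0 < n.-1)%N; rewrite [L 0]/= dim_full in d0.
rewrite leqNgt; apply/negP => d1.
have [e eL] : exists e, e \notin L 1.
  apply: contrapT => H; suff : (fullv <= L 1)%VS by move/dimvS; rewrite dim_full leqNgt d0.
  by apply/subvP => v _; apply: contrapT => /negP vL; apply: H; exists v.
have dec v : exists c, v - c *: e \in L 1.
  by apply: (vspace_hyperplane (subvf (L 1)) (memvf e) eL _ (memvf v)); rewrite dim_full; lia.
have := lcs_dim_lt (ltac:(lia) : 1 < n.-1)%N; rewrite ltnNge => /negP; apply.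
apply: dimvS; apply: lcs_sub => x y _.
have [[a xa] [b yb]] := (dec x, dec y).
rewrite -[x](subrK (a *: e)) -[y](subrK (b *: e)).
move: (x - _) (y - _) xa yb => x' y' xa yb; rewrite brDl !brDr !brZl !brZr.
case: (lie_mu) => alt _; rewrite alt !scaler0 addr0.
have ex : br mu x' e \in L 2 by rewrite (br_anti _ e alt) memvN lcs_br.
apply: memvD; [apply: memvD; [exact: lcs_br|exact: memvZ]|apply: memvZ; exact: lcs_br].
Qed.

Lemma lcs_dim k : (0 < k)%N -> (k < n)%N -> \dim (L k) = (n.-1 - k)%N.
Proof.
move=> k0 kn; apply/eqP; rewrite eqn_leq; apply/andP; split.
  elim: k k0 kn => // -[_ _ _|k IH _ kn]; first by rewrite (leq_trans lcs1_dim) //; lia.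
  have := IH isT (ltnW kn); have := lcs_dim_lt (ltac:(lia) : k.+1 < n.-1)%N; lia.
have H i : (i < n)%N -> (i <= \dim (L (n.-1 - i)))%N.
  elim: i => // i IH ni.
  have := lcs_dim_lt (ltac:(lia) : n.-1 - i.+1 < n.-1)%N.
  rewrite (_ : (n.-1 - i.+1).+1 = n.-1 - i)%N; last lia.
  by have := IH (ltnW ni); lia.
have := H (n.-1 - k)%N; rewrite (_ : n.-1 - (n.-1 - k) = k)%N; last lia.
by apply; lia.
Qed.

Lemma lcs_decomp k e v : (0 < k)%N -> (k < n.-1)%N -> e \in L k -> e \notin L k.+1 ->
  v \in L k -> exists c, v - c *: e \in L k.+1.
Proof.
move=> k0 kn ek ek1; apply: vspace_hyperplane => //; first exact: lcsS_sub.
by rewrite !lcs_dim //; lia.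
Qed.

(** Says that [ad x] induces a nonzero map from [L k / L k.+1] to [L k.+1 / L k.+2]. *)
Definition acts_at x k := exists2 y, y \in L k & br mu x y \notin L k.+2.

Lemma acts_at_exists k : (k.+1 < n.-1)%N -> exists x, acts_at x k.
Proof.
move=> kn; apply: contrapT => H.
have := lcs_dim_lt kn; rewrite ltnNge => /negP; apply; apply: dimvS.
apply: lcs_sub => x y yk; apply: contrapT => /negP Hxy; apply: H.
by exists x, y.
Qed.

(** The failing vectors form a subspace: two failing points on the line would make both [u] and [x]
    fail. So at most one [t] is bad for each [k], and a common good one exists for finitely many
    [k]. *)
Lemma acts_at_eventually x u k : acts_at x k \/ acts_at u k ->
  exists N, forall t, (N <= t)%N -> acts_at (x + t%:R *: u) k.
Proof.
move=> xu; have [[t0 Ht0]|H] := pselect (exists t, ~ acts_at (x + t%:R *: u) k); last first.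
  by exists 0%N => t _; apply: contrapT => Ht; apply: H; exists t.
exists t0.+1 => t t0t; apply: contrapT => Ht.
have bad s y : ~ acts_at s k -> y \in L k -> br mu s y \in L k.+2.
  by move=> Hs yk; apply: contrapT => /negP Hy; apply: Hs; exists y.
have badu y : y \in L k -> br mu u y \in L k.+2.
  move=> yk; have := memvB (bad _ _ Ht yk) (bad _ _ Ht0 yk).
  rewrite !brDl !brZl opprD addrACA subrr add0r -scalerBl -natrB ?(ltnW t0t) //.
  move=> H; have t0' : (t - t0)%:R != 0 :> C by rewrite pnatr_eq0 subn_eq0 -ltnNge.
  by rewrite -(scalerK t0' (br mu u y)) memvZ.
have badx y : y \in L k -> br mu x y \in L k.+2.
  move=> yk; have := bad _ _ Ht yk; rewrite brDl brZl => H.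
  by rewrite -[br mu x y](addrK (t%:R *: br mu u y)) memvB // memvZ // badu.
by case: xu => -[y yk]; rewrite ?(badx y yk) ?(badu y yk).
Qed.

Lemma generic_element : exists x, forall k, (0 < k)%N -> (k.+1 < n.-1)%N -> acts_at x k.
Proof.
suff H m : exists x, forall k, (0 < k)%N -> (k <= m)%N -> (k.+1 < n.-1)%N -> acts_at x k.
  by have [x Hx] := H n; exists x => k k0 kn; apply: Hx => //; lia.
elim: m => [|m [x Hx]]; first by exists 0 => k; lia.
have [mn|nm] := ltnP m.+2 n.-1; last by exists x => k k0 km kn; apply: Hx => //; lia.
have [u Hu] := acts_at_exists mn.
have [N HN] : exists N, forall t, (N <= t)%N ->
    forall k, (0 < k)%N -> (k <= m.+1)%N -> (k.+1 < n.-1)%N -> acts_at (x + t%:R *: u) k.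
  have: (m.+1 <= m.+1)%N by []; elim: {-2}(m.+1) => [|p IH] pm.
    by exists 0%N => t _ k; lia.
  have [N1 H1] := IH (ltnW pm).
  have [N2 H2] : exists N, forall t, (N <= t)%N -> acts_at (x + t%:R *: u) p.+1.
    apply: acts_at_eventually; have [->|pm'] := eqVneq p m; first by right.
    by left; apply: Hx => //; lia.
  exists (maxn N1 N2) => t; rewrite geq_max => /andP[t1 t2] k k0 kp kn.
  have [->|kp'] := eqVneq k p.+1; first exact: H2.
  by apply: H1 => //; lia.
by exists (x + N%:R *: u); exact: HN.
Qed.

(** The quotient [L 2 / L 3] is a line, so a multiple of [x0] can be subtracted from any vector
    independent of it modulo [L 1] to kill its action from [L 1 / L 2] to [L 2 / L 3]. This makes
    the coefficient of [x_3] in [[x_1, x_2]] vanish. *)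
Lemma adapted_pair : exists x0 x1,
  [/\ forall k, (0 < k)%N -> (k.+1 < n.-1)%N -> acts_at x0 k,
      x1 \notin (<[x0]> + L 1)%VS & forall y, y \in L 1 -> br mu x1 y \in L 3].
Proof.
have [x0 Hx0] := generic_element.
have [y0 y0L y0nL] := Hx0 1%N isT (ltac:(lia)).
have [u uU] : exists u, u \notin (<[x0]> + L 1)%VS.
  apply: contrapT => H; suff : (fullv <= <[x0]> + L 1)%VS.
    move/dimvS; rewrite dim_full; have [] := dimv_add_leqif <[x0]>%VS (L 1).
    by rewrite dim_vline (lcs_dim (ltn0Sn 0)); [case: (x0 != 0); lia|lia].
  by apply/subvP => v _; apply: contrapT => /negP vL; apply: H; exists v.
have [c Hc] := lcs_decomp (ltac:(lia) : 0 < 2)%N (ltac:(lia) : 2 < n.-1)%N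
  (lcs_br x0 y0L) y0nL (lcs_br u y0L).
exists x0, (u - c *: x0); split=> // [|y yL].
  apply: contra uU => H; rewrite -[u](subrK (c *: x0)) memvD // memvZ //.
  by apply: (subvP (addvSl _ _)); exact: memv_line.
have y0nL2 : y0 \notin L 2 by apply: contra y0nL; exact: lcs_br.
have [d Hd] := lcs_decomp (ltn0Sn 0) (ltac:(lia) : 1 < n.-1)%N y0L y0nL2 yL.
rewrite -[y](subrK (d *: y0)) brDr brZr memvD //; first exact: lcs_br.
by rewrite memvZ // brDl brNl brZl.
Qed.

Section AdaptedBasis.
Variables x0 x1 : V.
Hypotheses (x0_acts : forall k, (0 < k)%N -> (k.+1 < n.-1)%N -> acts_at x0 k)
  (x1_notin : x1 \notin (<[x0]> + L 1)%VS)
  (x1_central : forall y, y \in L 1 -> br mu x1 y \in L 3).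

Definition adapted k := if k is k'.+1 then iter k' (br mu x0) x1 else x0.

Lemma adapted_lcs k : adapted k.+1 \in L k.
Proof. by elim: k => [|k IH]; [exact: memvf|exact: lcs_br]. Qed.

Lemma adapted_span1 v : exists a b, v - a *: x0 - b *: x1 \in L 1.
Proof.
have x0L : x0 \notin L 1.
  apply/negP => x0L; have [y yL] := x0_acts (ltn0Sn 0) (ltac:(lia) : 2 < n.-1)%N.
  by case/negP; exact: (lcs_br_lcs x0L yL).
have d : (n.-1 <= \dim (<[x0]> + L 1))%N.
  have : (\dim (L 1) < \dim (<[x0]> + L 1))%N; last by rewrite lcs_dim //; lia.
  rewrite ltn_neqAle dimvS ?addvSr // andbT; apply: contra x0L => /eqP dE.
  have /eqP -> : L 1 == (<[x0]> + L 1)%VS by rewrite eqEdim addvSr dE leqnn.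
  by rewrite memvE addvSl.
have [|b /memv_addP[_ /vlineP[a ->] [u uL E]]] :=
  vspace_hyperplane (subvf _) (memvf x1) x1_notin _ (memvf v).
  by rewrite dim_full (leq_trans (leqSpred n)).
by exists a, b; rewrite addrAC E addrAC subrr add0r.
Qed.

(** Modulo [L 2] every bracket is a multiple of [[x_0, x_1]], which hence lies outside [L 2].
    Afterwards [x_0] maps the line [L k / L k.+1] nontrivially. *)
Lemma adapted_notin k : (0 < k)%N -> (k < n.-1)%N -> adapted k.+1 \notin L k.+1.
Proof.
have [alt _] := lie_mu.
elim: k => // -[_ _ _|k IH _ kn].
  apply/negP => x2L.
  have := lcs_dim_lt (ltac:(lia) : 1 < n.-1)%N; rewrite ltnNge => /negP; apply.
  apply: dimvS; apply: lcs_sub => x y _.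
  have [[a [b xab]] [c [d ycd]]] := (adapted_span1 x, adapted_span1 y).
  have -> : y = (y - c *: x0 - d *: x1) + (c *: x0 + d *: x1) by rewrite -(addrA y) -opprD subrK.
  move: (y - _ - _) ycd => y' ycd.
  have -> : x = (x - a *: x0 - b *: x1) + (a *: x0 + b *: x1) by rewrite -(addrA x) -opprD subrK.
  move: (x - _ - _) xab => x' xab.
  rewrite brDr; apply: memvD; first exact: lcs_br.
  rewrite brDl; apply: memvD; first by rewrite (br_anti _ _ alt) memvN; exact: lcs_br.
  rewrite !(brDl, brDr, brZl, brZr) !alt (br_anti x1 x0 alt) !scaler0 add0r addr0.
  by rewrite memvD // !memvZ // memvN.
have [y yL ynL] := x0_acts (ltn0Sn k) kn.
have [c Hc] := lcs_decomp (ltn0Sn k) (ltnW kn) (adapted_lcs _) (IH isT (ltnW kn)) yL.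
apply: contra ynL => H; rewrite -[y](subrK (c *: adapted k.+2)) brDr brZr.
by rewrite memvD ?memvZ // lcs_br.
Qed.

Definition adapted_mx : 'M[C]_n := \matrix_(i, j) adapted j i ord0.

Lemma adapted_mxE (j : 'I_n) : adapted_mx *m delta_mx j ord0 = adapted j.
Proof. by rewrite -colE; apply/colP => i; rewrite !mxE. Qed.

Lemma adapted_span k v : (0 < k)%N -> v \in L k ->
  exists2 w : V, v = adapted_mx *m w & forall i : 'I_n, (i <= k)%N -> w i ord0 = 0.
Proof.
have top j : (n.-1 <= j)%N -> L j = 0%VS.
  case: nil_mu => L0 _ /lcs_subset; rewrite L0 subv0 => /eqP; exact.
move: {2}(n.-1 - k)%N (leqnn (n.-1 - k)) => m.
elim: m k v => [|m IH] k v mk k0 vk.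
  exists 0 => [|i _]; last by rewrite mxE.
  by move: vk; rewrite top ?memv0 ?mulmx0 => [/eqP|]; [|lia].
have [kn|nk] := ltnP k n.-1; last by apply: (IH k) => //; lia.
have [c Hc] := lcs_decomp k0 kn (adapted_lcs k) (adapted_notin k0 kn) vk.
have [w vE w0] := IH k.+1 _ (ltac:(lia)) (ltn0Sn k) Hc.
have k1n : (k.+1 < n)%N by lia.
exists (w + c *: delta_mx (Ordinal k1n) ord0).
  by rewrite mulmxDr -vE -scalemxAr adapted_mxE subrK.
move=> i ik; rewrite !mxE w0 ?leqW // add0r -val_eqE /= ltn_eqF ?mulr0 //.
Qed.

Lemma adapted_mx_unit : adapted_mx \in unitmx.
Proof.
have surj v : exists w : V, adapted_mx *m w = v.
  have [a [b /adapted_span[//|w vE _]]] := adapted_span1 v.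
  have [n0 n1] : (0 < n)%N /\ (1 < n)%N by lia.
  exists (w + b *: delta_mx (Ordinal n1) ord0 + a *: delta_mx (Ordinal n0) ord0).
  by rewrite !mulmxDr -vE -!scalemxAr !adapted_mxE /= !subrK.
pose q (j : 'I_n) := projT1 (cid (surj (delta_mx j ord0))).
apply: (proj1 (mulmx1_unit (B := \matrix_(i, j) q j i ord0) _)).
apply/matrixP => i j; have := projT2 (cid (surj (delta_mx j ord0))).
move/colP/(_ i); rewrite !mxE andbT => <-.
by apply: eq_bigr => k _; rewrite !mxE.
Qed.

Lemma adapted_coord k v (i : 'I_n) : (0 < k)%N -> v \in L k -> (i <= k)%N ->
  (invmx adapted_mx *m v) i ord0 = 0.
Proof.
move=> k0 /(adapted_span k0)[w -> w0] ik.
by rewrite mulKmx ?adapted_mx_unit // w0.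
Qed.

Lemma adapted_act (i j : 'I_n) :
  gl_act (invmx adapted_mx) mu i j = invmx adapted_mx *m br mu (adapted i) (adapted j).
Proof. by rewrite mxE invmxK !adapted_mxE. Qed.

End AdaptedBasis.

Lemma exists_adapted_basis : exists2 nu : bilmap R n, isomorphic mu nu &
  [/\ lie_variety nu,
      forall i j k : 'I_n, (0 < i)%N -> (0 < j)%N -> (k < i + j)%N -> nu i j k ord0 = 0,
      forall i j k : 'I_n, nat_of_ord i = 1%N -> nat_of_ord j = 2%N -> nat_of_ord k = 3%N ->
        nu i j k ord0 = 0
    & forall i j k : 'I_n, nat_of_ord i = 0%N -> (0 < j)%N ->
        nu i j k ord0 = (k == j.+1 :> nat)%:R].
Proof.
have [x0 [x1 [x0_acts x1_notin x1_central]]] := adapted_pair.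
have PU := adapted_mx_unit x0_acts x1_notin.
set P := adapted_mx x0 x1 in PU *.
exists (gl_act (invmx P) mu); first by exists (invmx P); rewrite ?unitmx_inv.
split.
- by apply: lie_variety_act; rewrite ?unitmx_inv.
- move=> i j k i0 j0 kij; rewrite adapted_act.
  have := lcs_br_lcs (adapted_lcs x0 x1 i.-1) (adapted_lcs x0 x1 j.-1).
  rewrite !prednK // => H; apply: (adapted_coord x0_acts x1_notin _ H); lia.
- move=> i j k iE jE kE; rewrite adapted_act iE jE.
  apply: (adapted_coord x0_acts x1_notin (k := 3)) => //; last by rewrite kE.
  exact/x1_central/(adapted_lcs x0 x1 1).
- move=> i j k iE j0; rewrite adapted_act iE.
  have -> : br mu (adapted x0 x1 0) (adapted x0 x1 j) = adapted x0 x1 j.+1.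
    by rewrite -[in LHS](prednK j0) -[in RHS](prednK j0).
  have [jn|nj] := ltnP j.+1 n.
    rewrite -[adapted x0 x1 j.+1](adapted_mxE x0 x1 (Ordinal jn)) mulKmx // mxE andbT.
    by rewrite -val_eqE.
  have H := adapted_lcs x0 x1 j; rewrite ltn_eqF; last by apply: leq_trans nj.
  by apply: (adapted_coord x0_acts x1_notin j0 H); have := ltn_ord k; lia.
Qed.

End DescendingSeries.

(** * The associated graded algebra: [c i j] is the coefficient of [x_(i+j)] in [[x_i, x_j]] *)

Section GradedConstants.
Variables (F : numFieldType) (n : nat) (c : nat -> nat -> F).
Hypotheses (c_anti : forall i j, c i j = - c j i)
  (c_rec : forall i j, (0 < i)%N -> (0 < j)%N -> ((i + j).+1 < n)%N ->
     c i j = c i.+1 j + c i j.+1)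
  (c_jacobi : forall i j k, (0 < i)%N -> (0 < j)%N -> (0 < k)%N -> (i + j + k < n)%N ->
     c i j * c (i + j)%N k + c j k * c (j + k)%N i + c k i * c (k + i)%N j = 0)
  (c12 : c 1 2 = 0).

Lemma c_diag i : c i i = 0.
Proof.
have /eqP := c_anti i i.
by rewrite -addr_eq0 -mulr2n -mulr_natl mulf_eq0 pnatr_eq0 => /eqP.
Qed.

(* The graded algebra is the graded Lie algebra of [mu_0] below its top degree: if the weight
   [m] part does not vanish, it determines the weight [m.+1] part, and the Jacobi identity for
   [x_1, x_2, x_(m - 2)] fails. *)
Lemma graded_constants_eq0 i j : (0 < i)%N -> (0 < j)%N -> ((i + j).+1 < n)%N -> c i j = 0.
Proof.
suff H m : (m.+1 < n)%N -> forall i j, (0 < i)%N -> (0 < j)%N -> (i + j = m)%N -> c i j = 0.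
  by move=> i0 j0 ijn; exact: (H _ ijn).
elim/ltn_ind: m => m IH mn {}i {}j i0 j0 ijm.
have [m4|m5] := ltnP m 5.
  have c13 : (4 < n)%N -> c 1 3 = 0.
    by move=> n4; have := c_rec (ltn0Sn 0) (ltn0Sn 1) n4; rewrite c12 c_diag add0r.
  have : i = j \/ (i = 1 /\ j = 2 \/ i = 2 /\ j = 1) \/ (i = 1 /\ j = 3 \/ i = 3 /\ j = 1)%N by lia.
  case=> [->|[[[-> ->]|[-> ->]]|[[iE jE]|[iE jE]]]]; first exact: c_diag.
  - exact: c12.
  - by rewrite c_anti c12 oppr0.
  - by rewrite iE jE c13 //; lia.
  - by rewrite iE jE c_anti c13 ?oppr0 //; lia.
pose d p := c p (m - p)%N; pose e p := c p (m.+1 - p)%N.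
have d_rec p : (0 < p)%N -> (p.+1 < m)%N -> d p.+1 = - d p.
  move=> p0 pm; have [p1 pmn] : (0 < m - p.+1)%N /\ ((p + (m - p.+1)).+1 < n)%N by lia.
  have := c_rec p0 p1 pmn; rewrite (IH (p + (m - p.+1))%N) //; [|lia..].
  rewrite (_ : (m - p.+1).+1 = m - p)%N; last lia.
  by move=> /esym/eqP; rewrite addr_eq0 => /eqP.
have e_rec p : (0 < p)%N -> (p < m)%N -> e p.+1 = d p - e p.
  move=> p0 pm; have [p1 pmn] : (0 < m - p)%N /\ ((p + (m - p)).+1 < n)%N by lia.
  rewrite /d (c_rec p0 p1 pmn) /e (_ : (m - p).+1 = m.+1 - p)%N; last lia.
  by rewrite subSS addrK.
have dE p : (p.+1 < m)%N -> d p.+1 = (-1) ^+ p * d 1%N.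
  elim: p => [|p IHp] pm; first by rewrite mul1r.
  by rewrite d_rec // IHp ?exprS; [ring|lia].
have eE p : (p < m)%N -> e p.+1 = (-1) ^+ p * (e 1%N - p%:R * d 1%N).
  elim: p => [|p IHp] pm; first by rewrite mul0r subr0 mul1r.
  by rewrite e_rec // dE // IHp ?exprS ?mulrS; [ring|lia].
suff d1 : d 1%N = 0.
  have -> : c i j = d i by rewrite /d -ijm addKn.
  by rewrite -(prednK i0) dE ?d1 ?mulr0 //; lia.
(* For even [m] the middle constant [c h h] is zero, and so is [d 1]. For odd [m] the middle
   constant in degree [m.+1] is zero, which yields [e 1 = h * d 1]. *)
have [h [mE|mE]] : exists h, m = (2 * h)%N \/ m = (2 * h).+1.
  by exists m./2; have := odd_double_half m; rewrite -muln2; case: (odd m); lia.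
- have : d h = 0 by rewrite /d (_ : m - h = h)%N ?c_diag //; lia.
  rewrite -(prednK (ltac:(lia) : 0 < h)%N) dE; last lia.
  by move/eqP; rewrite mulf_eq0 signr_eq0 /= => /eqP.
have : e h.+1 = 0 by rewrite /e (_ : m.+1 - h.+1 = h.+1)%N ?c_diag //; lia.
rewrite eE; last lia.
move/eqP; rewrite mulf_eq0 signr_eq0 /= subr_eq0 => /eqP e1E.
(* Only the term through [[x_2, x_(m-2)]] survives; it equals [d 1 * e 1], that is [h * d 1 ^+ 2].
   It lives in degree [m.+1], which must stay below [n]: hence the top degree is excluded. *)
have := @c_jacobi 1 2 (m - 2) isT isT (ltac:(lia)) (ltac:(lia)).
rewrite c12 mul0r add0r [c (m - 2)%N 1%N](IH (m - 1)%N); [|lia..].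
rewrite mul0r addr0 (_ : 2 + (m - 2) = m)%N; last lia.
have -> : c 2 (m - 2) = - d 1%N by rewrite -[LHS]/(d 2%N) d_rec //; lia.
have -> : c m 1 = - e 1%N by rewrite c_anti /e subn1.
rewrite e1E => /eqP; rewrite mulrN mulNr opprK mulrCA !mulf_eq0 orbb pnatr_eq0.
by case/orP=> /eqP //; lia.
Qed.

End GradedConstants.

(** * Vergne's theorem: the parameters of a bracket in an adapted basis *)

Section VergneNormalForm.
Variables (R : realType) (n : nat) (nu : bilmap R n).
Local Notation C := (Cplx R).
Hypotheses (n_ge4 : (4 <= n)%N) (lie_nu : lie_variety nu)
  (nu_graded : forall i j k : 'I_n, (0 < i)%N -> (0 < j)%N -> (k < i + j)%N ->
     nu i j k ord0 = 0)
  (nu123 : forall i j k : 'I_n, nat_of_ord i = 1%N -> nat_of_ord j = 2%N ->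
     nat_of_ord k = 3%N -> nu i j k ord0 = 0)
  (nu0 : forall i j k : 'I_n, nat_of_ord i = 0%N -> (0 < j)%N ->
     nu i j k ord0 = (k == j.+1 :> nat)%:R).

Definition struct_const i j k : C :=
  if (insub i, insub j, insub k) is (Some i', Some j', Some k') then nu i' j' k' ord0 else 0.
Local Notation K := struct_const.

Lemma struct_constE (i j k : 'I_n) : K i j k = nu i j k ord0.
Proof. by rewrite /K !valK. Qed.

Lemma struct_const_out i j k : (n <= i)%N || (n <= j)%N || (n <= k)%N -> K i j k = 0.
Proof.
rewrite /K; case: insubP => [i' iN iE|//]; case: insubP => [j' jN jE|//].
by case: insubP => [k' kN kE|//]; lia.
Qed.

Lemma struct_const_anti i j k : K i j k = - K j i k.
Proof.
have alt := lie_nu.1; rewrite /K; case: insubP => [i' _ _|_]; last by case: insubP; rewrite oppr0.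
case: insubP => [j' _ _|_]; last by rewrite oppr0.
case: insubP => [k' _ _|_]; last by rewrite oppr0.
by rewrite -(br_delta nu i') (br_anti _ _ alt) br_delta mxE.
Qed.

Lemma struct_const_graded i j k : (0 < i)%N -> (0 < j)%N -> (k < i + j)%N -> K i j k = 0.
Proof.
rewrite /K; case: insubP => [i' iN <-|//]; case: insubP => [j' jN <-|//].
by case: insubP => [k' kN <-|//] i0 j0 kij; exact: nu_graded.
Qed.

Lemma struct_const0 j k : (0 < j)%N -> (j < n)%N -> (k < n)%N -> K 0 j k = (k == j.+1)%:R.
Proof.
move=> j0 jn kn; have n0 : (0 < n)%N by lia.
rewrite -[0%N]/(nat_of_ord (Ordinal n0)) -[j]/(nat_of_ord (Ordinal jn)).
by rewrite -[k]/(nat_of_ord (Ordinal kn)) struct_constE nu0.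
Qed.

Lemma struct_const_jac i j k l : (i < n)%N -> (j < n)%N -> (k < n)%N -> (l < n)%N ->
  jac n K i j k l = 0.
Proof.
move=> iN jN kN lN; have [_ jacn] := lie_nu.
have [H _] := jacobi_const (fun i j k : 'I_n => esym (struct_constE i j k)).
exact: (H jacn (Ordinal iN) (Ordinal jN) (Ordinal kN) (Ordinal lN)).
Qed.

(** This is the coefficient of [x_(k+1)] in the Jacobi identity for [x_0], [x_i], [x_j]. *)
Lemma struct_const_rec i j k : (0 < i)%N -> (0 < j)%N -> (k.+1 < n)%N ->
  K i j k = K i.+1 j k.+1 + K i j.+1 k.+1.
Proof.
move=> i0 j0 kn.
have [ni|iN] := leqP n i; first by rewrite !struct_const_out ?addr0 //; lia.
have [nj|jN] := leqP n j; first by rewrite !struct_const_out ?addr0 //; lia.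
have n0 : (0 < n)%N by lia.
have := struct_const_jac n0 iN jN kn; rewrite /jac !big_split /=.
have shift p q : (0 < p)%N -> (p < n)%N ->
    \sum_(m < n) K 0 p m * K m q k.+1 = K p.+1 q k.+1.
  move=> p0 pn; have [p1|np] := ltnP p.+1 n; last first.
    rewrite (struct_const_out (i := p.+1)) ?np // big1 // => m _.
    by rewrite struct_const0 // ltn_eqF ?mul0r //; apply: leq_trans np.
  rewrite (sum_only1 (f := fun m => K 0 p m * K m q k.+1) p1) => [|m mn mp].
    by rewrite struct_const0 // eqxx mul1r.
  by rewrite struct_const0 //; case: eqP => // _; rewrite mul0r.
rewrite shift // (sum_only1 (f := fun m => K i j m * K m 0 k.+1) (ltnW kn)) => [|m mn mk].
  rewrite (eq_bigr (fun m : 'I_n => - (K 0 j m * K m i k.+1))); last first.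
    by move=> m _; rewrite (struct_const_anti j 0) mulNr.
  rewrite sumrN shift // (struct_const_anti k) (struct_const_anti j.+1) opprK.
  have [->|k0] := posnP k.
    rewrite (@struct_const_graded i j 0) ?addn_gt0 ?i0 // mul0r addr0 => ->; done.
  rewrite struct_const0 ?(ltnW kn) // eqxx mulrN1 => /eqP.
  by rewrite addrAC subr_eq0 => /eqP.
have [->|m0] := posnP m; first by rewrite struct_const_graded ?addn_gt0 ?i0 ?mul0r.
rewrite (struct_const_anti m) struct_const0 //.
by case: eqP => [[/esym]//|_]; rewrite oppr0 mulr0.
Qed.

Lemma struct_const_top i j : (0 < i)%N -> (0 < j)%N -> ((i + j).+1 < n)%N -> K i j (i + j) = 0.
Proof.
move=> i0 j0 ijn; apply: (@graded_constants_eq0 _ n (fun i j => K i j (i + j)%N)) => //.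
- by move=> p q; rewrite struct_const_anti addnC.
- by move=> p q p0 q0 pq; rewrite struct_const_rec // addSn addnS.
- move=> p q r p0 q0 r0 pqr.
  have [pn [qn rn]] : (p < n)%N /\ (q < n)%N /\ (r < n)%N by lia.
  have := struct_const_jac pn qn rn pqr; rewrite /jac !big_split /=.
  have top x y z : (0 < x)%N -> (0 < y)%N -> (0 < z)%N -> (x + y + z = p + q + r)%N ->
      \sum_(m < n) K x y m * K m z (p + q + r)%N = K x y (x + y)%N * K (x + y)%N z (x + y + z)%N.
    move=> x0 y0 z0 E; have xyn : (x + y < n)%N by lia.
    rewrite (sum_only1 (f := fun m => K x y m * K m z (p + q + r)%N) xyn) => [|m mn mxy].
      by rewrite E.
    have [lt|ge] := ltnP m (x + y); first by rewrite struct_const_graded ?mul0r.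
    by rewrite (@struct_const_graded m z) ?mulr0 //; lia.
  by rewrite !top //; lia.
- have [n1 [n2 n3]] : (1 < n)%N /\ (2 < n)%N /\ (3 < n)%N by lia.
  rewrite -[1%N]/(nat_of_ord (Ordinal n1)) -[2%N]/(nat_of_ord (Ordinal n2)).
  by rewrite -[(_ + _)%N]/(nat_of_ord (Ordinal n3)) struct_constE nu123.
Qed.

Definition vergne_coef r s := if in_Delta n r s then K r r.+1 s else 0.

(** Cutting down to [Delta] loses nothing: below [s = 2 r + 1] the grading gives zero, and at
    [s = 2 r + 1 < n - 1] the vanishing of the graded constants does. *)
Lemma vergne_coefE r s : (0 < r)%N -> (s < n)%N -> vergne_coef r s = K r r.+1 s.
Proof.
move=> r0 sn; rewrite /vergne_coef; case: ifP => // H; symmetry.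
have [lt|ge] := ltnP s (r + r.+1); first exact: struct_const_graded.
have -> : s = (r + r.+1)%N by move: H; rewrite /in_Delta; lia.
apply: struct_const_top => //; move: H; rewrite /in_Delta; lia.
Qed.

Lemma supported_vergne_coef : supported n vergne_coef.
Proof. by move=> r s /negPf H; rewrite /vergne_coef H. Qed.

(** Both sides are antisymmetric, obey the derivation rule of [ad x_0] and agree on consecutive
    indices; the rule propagates the agreement by induction on [j - i]. *)
Lemma struct_const_psi i j k : (0 < i)%N -> (0 < j)%N -> (k < n)%N ->
  K i j k = psi_const vergne_coef i j k.
Proof.
have sA := supported_vergne_coef.
have lt_case d : forall i k, (0 < i)%N -> (k < n)%N ->
    K i (i + d.+1) k = psi_const vergne_coef i (i + d.+1) k.
  elim/ltn_ind: d => -[|d] IH {}i {}k i0 kn.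
    by rewrite addn1 /psi_const gtn_eqF //= ltnS leqnn psi_coef_succ vergne_coefE.
  case: k kn => [|k] kn.
    by rewrite struct_const_graded ?(psi_const_small sA) //; lia.
  have dn : (0 < i + d.+1)%N by lia.
  have E1 := struct_const_rec i0 dn kn.
  have E2 := psi_const_rec vergne_coef k i0 dn.
  rewrite addnS; apply: (addrI (K i.+1 (i + d.+1) k.+1)); rewrite -E1.
  rewrite (IH d (ltnSn d) i k i0 (ltnW kn)) E2; congr (_ + _); rewrite -addSnnS.
  case: d IH {dn E1 E2} => [|d] IH; last by rewrite IH.
  have /eqP := struct_const_anti i.+1 i.+1 k.+1; rewrite -addr_eq0 -mulr2n -mulr_natl.
  rewrite addn0 mulf_eq0 pnatr_eq0 /= => /eqP ->.
  by rewrite /psi_const ltnn.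
move=> i0 j0 kn; have [ij|ji|<-] := ssrnat.ltngtP i j.
- have -> : j = (i + (j - i).-1.+1)%N by lia.
  exact: lt_case.
- rewrite struct_const_anti psi_const_anti; congr (- _).
  have -> : i = (j + (i - j).-1.+1)%N by lia.
  exact: lt_case.
- have /eqP := struct_const_anti i i k; rewrite -addr_eq0 -mulr2n -mulr_natl.
  rewrite mulf_eq0 pnatr_eq0 /= => /eqP ->.
  by rewrite /psi_const ltnn !if_same.
Qed.

Lemma vergne_bracket_of : exists2 a : coords R n, Fvar a & nu = bracket_of a.
Proof.
have sA := supported_vergne_coef.
have coefE : coef_of (@coords_of R n vergne_coef) = vergne_coef.
  by apply/funext => r; apply/funext => s; rewrite coords_ofK.
have nuE : nu = bracket_of (@coords_of R n vergne_coef).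
  apply/matrixP => i j; apply/colP => k; rewrite bracket_of_entry // coefE.
  rewrite -struct_constE; case: (posnP i) => [i0|i0].
    case: (posnP j) => [j0|j0].
      have iE : i = j by apply: val_inj; rewrite /= i0 j0.
      rewrite iE mu_const_diag; have /eqP := struct_const_anti j j k.
      by rewrite -addr_eq0 -mulr2n -mulr_natl mulf_eq0 pnatr_eq0 => /eqP.
    by rewrite i0 mu_const0 // struct_const0.
  case: (posnP j) => [j0|j0].
    by rewrite j0 mu_const_anti struct_const_anti mu_const0 // struct_const0.
  by rewrite mu_const_pos // struct_const_psi.
by exists (coords_of vergne_coef) => //; apply/lie_bracket_of; rewrite -?nuE.
Qed.

End VergneNormalForm.

(** * Nearby non-isomorphic brackets and the failure of rigidity *)

Lemma vergne_normal_form (R : realType) (n : nat) (mu : bilmap R n) :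
  (4 <= n)%N -> filiform mu ->
  exists2 a : coords R n, Fvar a & isomorphic mu (bracket_of a).
Proof.
move=> n4 [lie_mu nil_mu].
have [nu iso_nu [lie_nu graded nu123 nu0]] := exists_adapted_basis n4 lie_mu nil_mu.
have [a Fa nuE] := vergne_bracket_of n4 lie_nu graded nu123 nu0.
by exists a; rewrite -?nuE.
Qed.

Lemma nonisomorphic_nearby (R : realType) (n : nat) (a : coords R n) (V : set (coords R n)) :
  n = 9%N \/ n = 10%N \/ n = 11%N -> Fvar a -> nbhs (a : subspace (@Fvar R n)) V ->
  exists b : coords R n,
    [/\ V b, Fvar b, filiform (bracket_of b)
      & ~ isomorphic (bracket_of a) (bracket_of b)].
Proof.
move=> hn Fa aV; have n9 : (9 <= n)%N by lia.
have n4 : (4 <= n)%N by lia.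
have sA := supported_coef_of n4 a.
have Ja := (Fvar_jac n4 a).1 Fa.
apply: deformable_coords => //; case: hn => [nE|[nE|nE]]; subst n.
- by apply: deformable9 => //; apply/(jac_psi9 sA).
- by have [E8 E9 Ec] := (jac_psi10 sA).1 Ja; exact: deformable10.
- by have [E8 E9 E10 Et] := (jac_psi11 sA).1 Ja; exact: deformable11.
Qed.

Lemma filiform_not_rigid (R : realType) (n : nat) (mu : bilmap R n) :
  n = 9%N \/ n = 10%N \/ n = 11%N -> filiform mu -> ~ rigid mu.
Proof.
move=> hn fil_mu [_ /open_subspaceP[U oU UE]].
have n4 : (4 <= n)%N by lia.
have [a Fa mu_a] := vergne_normal_form n4 fil_mu.
have orbitE nu : lie_variety nu -> U nu <-> isomorphic mu nu.
  move=> lie_nu; split=> H.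
    have : (U `&` @lie_variety R n) nu by split.
    by rewrite UE; case.
  have : (gl_orbit mu `&` @lie_variety R n) nu by split.
  by rewrite -UE; case.
have lie_of b : Fvar b -> lie_variety (@bracket_of R n b) by move/(lie_bracket_of n4).
(* An open orbit would pull back along the continuous map [bracket_of] to a neighbourhood of [a]
   consisting of brackets isomorphic to [mu]. *)
have aV : nbhs (a : subspace (@Fvar R n)) (@bracket_of R n @^-1` U).
  rewrite /nbhs /= -nbhs_subspace_in //.
  apply: (@filterS _ (nbhs a) _ (@bracket_of R n @^-1` U)) => [b Ub _ //|].
  apply: bracket_of_continuous; apply: open_nbhs_nbhs; split=> //.
  by apply/orbitE => //; exact: lie_of.
have [b [Ub Fb _ []]] := nonisomorphic_nearby hn Fa aV.
apply: isomorphic_trans (isomorphic_sym mu_a) _.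
by apply/orbitE => //; exact: lie_of.
Qed.

Local Close Scope ring_scope.

Theorem theorem6p1 (R : realType) (n : nat)
    (hn : n = 9 \/ n = 10 \/ n = 11) :
  (forall mu : bilmap R n, filiform mu -> ~ rigid mu) /\
  (forall a : coords R n, Fvar a ->
   forall V : set (coords R n),
     nbhs (a : subspace (@Fvar R n)) V ->
     exists b : coords R n,
       [/\ V b, Fvar b, filiform (bracket_of b)
         & ~ isomorphic (bracket_of a) (bracket_of b)]).
Proof.
split=> [mu|a Fa V aV]; first exact: filiform_not_rigid.
exact: nonisomorphic_nearby.
Qed.
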